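(* Let $\mathscr{B}\subset\mathbb{N}\setminus\{1\}$ be primitive and let $\eta=\mathbf{1}_{\mathcal{F}_{\mathscr{B}}}$. Then: (i) $\mathscr{B}$ is Erdős if and only if $X_\eta=X_{\mathscr{B}}$ and $h(X_\eta,S)>0$. (ii) $\mathscr{B}$ is Behrend if and only if $(X_\eta,S)$ is proximal and $h(X_\eta,S)=0$.
   Context: $\mathbb{N}=\{1,2,\ldots\}$. $\mathscr{B}$ is primitive if no element of $\mathscr{B}$ divides a different element of $\mathscr{B}$. $\mathcal{F}_{\mathscr{B}}=\mathbb{Z}\setminus\bigcup_{b\in\mathscr{B}}b\mathbb{Z}$ is the set of $\mathscr{B}$-free integers. $S$ is the left shift on $\{0,1\}^{\mathbb{Z}}$, $X_\eta:=\overline{\{S^j\eta:j\in\mathbb{Z}\}}$, and $h$ denotes topological entropy. $X_{\mathscr{B}}$ is the set of all $x\in\{0,1\}^{\mathbb{Z}}$ whose support $\{i:x(i)=1\}$ misses at least one residue class modulo $b$, for every $b\in\mathscr{B}$. $\mathscr{B}$ is Erdős if it is infinite, its elements are pairwise coprime, and $\sum_{b\in\mathscr{B}}1/b<\infty$. $\mathscr{B}$ is Behrend if the natural density $\lim_{N\to\infty}\frac1N|\mathcal{F}_{\mathscr{B}}\cap[1,N]|$ exists and equals $0$. A topological system $(X,T)$ with metric $d$ is proximal if for every $x,y\in X$ there is a sequence $(q_n)$ with $d(T^{q_n}x,T^{q_n}y)\to0$.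
   Formalization: Part (ii) is stated for nonempty 𝓑: for 𝓑 = ∅ the system X_η is a single fixed point, hence proximal with zero entropy, although 𝓑 is not Behrend, so (ii) fails there. *)

(* Defs.v *)
From HB Require Import structures.
From mathcomp Require Import all_boot all_order all_algebra.
From mathcomp Require Import all_classical all_reals all_analysis.

Set Implicit Arguments.
Unset Strict Implicit.
Unset Printing Implicit Defensive.

Import Order.TTheory GRing.Theory Num.Theory.
Import numFieldNormedType.Exports.

Local Open Scope classical_set_scope.
Local Open Scope ring_scope.

(* Systems (X, T) are given as a subset X of an ambient space E together with
   a self-map T of E; open covers of X are by open sets of E, which amounts to
   open covers of X in the subspace topology. *)

Section Entropy.
Variables (R : realType) (E : topologicalType).
Implicit Types (T : E -> E) (X : set E) (U : set (set E)).

Definition open_cover X U := U `<=` open /\ X `<=` \bigcup_(V in U) V.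

(* U \/ T^-1 U \/ ... \/ T^-(n-1) U *)
Definition cover_join T U (n : nat) : set (set E) :=
  [set V | exists2 F : nat -> set E,
    forall i, (i < n)%N -> U (F i) &
    V = \bigcap_(i < n) (iter i T @^-1` F i)].

(* Least cardinality of a finite subfamily of U covering X. *)
Definition cover_number X U : R :=
  inf [set k%:R | k in [set k : nat | exists A : set (set E),
    [/\ A `<=` U, (A #= `I_k)%card & X `<=` \bigcup_(V in A) V]]].

(* Adler-Konheim-McAndrew entropy. The limit exists by subadditivity, so it is
   written as a limsup. *)
Definition cover_entropy T X U : \bar R :=
  limn_esup (fun n => (ln (cover_number X (cover_join T U n)) / n%:R)%:E).

Definition entropy T X : \bar R :=
  ereal_sup [set cover_entropy T X U | U in open_cover X].

End Entropy.

Definition proximal (R : realType) (E : Type) (d : E -> E -> R)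
    (T : E -> E) (X : set E) :=
  forall x y, X x -> X y -> exists q : nat -> nat,
    (fun n => d (iter (q n) T x) (iter (q n) T y)) @ \oo --> (0 : R).

Section FullShift.

Definition config : Type := prod_topology (fun _ : int => bool).
HB.instance Definition _ := Topological.on config.

Definition shiftz (j : int) (x : config) : config := fun n => x (n + j).

Definition left_shift : config -> config := shiftz 1.

Definition orbit_closure (x : config) : set config :=
  closure (range (shiftz ^~ x)).

(* 2^-(min {|i| : x i != y i}), and sup set0 = 0 when x = y *)
Definition cdist (R : realType) (x y : config) : R :=
  sup [set 2^-1 ^+ `|i|%N | i in [set i : int | x i != y i]].

End FullShift.

(* cdist is a metric inducing the product topology of config. *)
Section CdistMetric.
Variable R : realType.
Implicit Types x y z : config.

Lemma cdist_has_ubound x y : has_ubound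
  [set (2^-1 ^+ `|i|%N : R) | i in [set i : int | x i != y i]].
Proof.
exists 1 => _ [i _ <-].
by rewrite exprn_ile1 ?invr_ge0// invf_le1 ?ler1n.
Qed.

Lemma cdist_lb x y i : x i != y i -> 2^-1 ^+ `|i|%N <= cdist R x y.
Proof. by move=> xy; apply: ub_le_sup; [exact: cdist_has_ubound|exists i]. Qed.

Lemma cdistxx x : cdist R x x = 0.
Proof.
rewrite /cdist (_ : [set _ | _ in _] = set0) ?sup0// -subset0.
by move=> e [i /=]; rewrite eqxx.
Qed.

Lemma cdist_gt0 x y : x != y -> 0 < cdist R x y.
Proof.
move=> xy; have [i xyi] : exists i, x i != y i.
  apply: contrapT => /forallNP h; move/eqP: xy; apply.
  by apply/funext => i; apply/eqP; have /negP := h i; rewrite negbK.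
by apply: lt_le_trans (cdist_lb xyi); rewrite exprn_gt0 ?invr_gt0.
Qed.

Lemma cdist_ge0 x y : 0 <= cdist R x y.
Proof.
by have [->|/cdist_gt0/ltW//] := eqVneq x y; rewrite cdistxx.
Qed.

Lemma cdist_eq0 x y : cdist R x y = 0 -> x = y.
Proof.
by have [//|/cdist_gt0 + xy0] := eqVneq x y; rewrite xy0 ltxx.
Qed.

Lemma cdistC x y : cdist R x y = cdist R y x.
Proof.
congr sup; apply/seteqP; split=> _ [i /= xy <-]; exists i => //=;
  by rewrite eq_sym.
Qed.

Lemma cdist_triangle x y z : cdist R x z <= cdist R x y + cdist R y z.
Proof.
have [->|xz] := eqVneq x z; first by rewrite cdistxx addr_ge0 ?cdist_ge0.
rewrite {1}/cdist; apply: ge_sup.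
  apply: contrapT => /nonemptyPn e0; move: (cdist_gt0 xz).
  by rewrite /cdist e0 sup0 ltxx.
move=> _ [i /= xzi <-]; have [xy|xy] := eqVneq (x i) (y i).
  by apply: ler_wpDl; [exact: cdist_ge0|apply: cdist_lb; rewrite -xy].
by apply: ler_wpDr; [exact: cdist_ge0|exact: cdist_lb].
Qed.

Lemma nbhs_cdist x (A : set config) :
  nbhs x A <-> exists2 e : R, 0 < e & [set y | cdist R x y < e] `<=` A.
Proof.
have h0 : 0 < 2^-1 :> R by rewrite invr_gt0.
have h1 : 2^-1 < 1 :> R by rewrite invf_lt1 ?ltr1n.
split=> [|[e e0 eA]].
  pose F := filter_from [set e : R | 0 < e]
    (fun e => [set y | cdist R x y < e]).
  have FF : ProperFilter F.
    apply: filter_from_proper => [|e /= e0]; last first.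
      by exists x; rewrite /= cdistxx.
    apply: filter_from_filter => [|e f /= e0 f0]; first by exists 1 => /=.
    exists (Num.min e f); first by rewrite /= lt_min e0.
    by move=> y /=; rewrite lt_min => /andP[].
  suff Fx : F --> x by move=> /Fx.
  apply/cvg_sup => i U [V [[W oW <-] Wx] WU].
  exists (2^-1 ^+ `|i|%N) => /=; first by rewrite exprn_gt0.
  move=> y /= xy; apply: WU; rewrite /preimage/=.
  have [xyi|/(@cdist_lb x y i)] := eqVneq (x i) (y i); last by rewrite leNgt xy.
  by move: Wx; rewrite /= xyi.
have [k ke] : exists k : nat, 2^-1 ^+ k < e.
  have /cvgrPdist_lt/(_ _ e0)[k _ /(_ k)] :
      (fun n : nat => 2^-1 ^+ n : R) @ \oo --> (0 : R).
    by apply: cvg_expr; rewrite gtr0_norm.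
  rewrite /= leqnn sub0r normrN gtr0_norm ?exprn_gt0// => /(_ isT) ?.
  by exists k.
pose P (n : nat) := [set y : config | forall i : int, (`|i| < n)%N -> y i = x i].
have coord i : nbhs x [set y : config | y i = x i].
  have := @proj_continuous int (fun _ => bool) i x.
  by move=> /(_ [set x i]); apply; exact/principal_filterP.
have nP n : nbhs x (P n).
  elim: n => [|n IHn]; first by apply: filterS filterT => y _ i.
  apply: filterS (filterI IHn (filterI (coord n%:Z) (coord (- n%:Z)))).
  move=> y [yP [/= y1 y2]] i; rewrite ltnS leq_eqVlt => /orP[/eqP iE|/yP//].
  by move: y1 y2; rewrite -iE; case: (i) => m; rewrite ?NegzE ?abszN.
apply: filterS (nP k) => y yP; apply: eA => /=; apply: le_lt_trans ke.
have [->|xy] := eqVneq x y; first by rewrite cdistxx exprn_ge0// ltW.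
apply: ge_sup.
  apply: contrapT => /nonemptyPn e0'; move: (cdist_gt0 xy).
  by rewrite /cdist e0' sup0 ltxx.
move=> _ [i /= xyi <-]; rewrite ler_iXn2l//.
by rewrite leqNgt; apply/negP => /yP yxi; rewrite yxi eqxx in xyi.
Qed.

End CdistMetric.

Section BFree.
Implicit Types B : set nat.

Definition primitive B :=
  forall a b, B a -> B b -> (a %| b)%N -> a = b.

Definition bfree B : set int :=
  [set: int] `\` \bigcup_(b in B) [set n : int | (b%:Z %| n)%Z].

Definition eta B : config := fun n => `[< bfree B n >].

Definition X_eta B : set config := orbit_closure (eta B).

Definition X_adm B : set config :=
  [set x | forall b, B b ->
    exists r : int, forall n : int, x n -> (n != r %[mod b%:Z])%Z].

Definition erdos (R : realType) B :=
  [/\ infinite_set B,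
      forall a b, B a -> B b -> a != b -> coprime a b &
      (\esum_(b in B) (b%:R^-1 : R)%:E < +oo)%E].

Definition behrend (R : realType) B :=
  (fun N => (count (fun n : nat => `[< bfree B n%:Z >]) (iota 1 N))%:R / N%:R) @ \oo
    --> (0 : R).

End BFree.

(* Main.v *)
(* Let F be the set of B-free numbers, F_K the periodic set of numbers free of
   B /\ [1, K], d_K its density and theta = inf d_K.

   Harris' inequality on divisor lattices gives d_N * H_N <= sum of 1/m over
   m <= N in F, where H_N is the harmonic number (a form of Davenport-Erdos).
   So theta = 0 iff B is Behrend, and for large K almost every element of F_K,
   in logarithmic average, lies in F; hence a pattern of elements of F_K whose
   positions have density bounded below independently of K also occurs in F.

   If theta = 0, counting words gives entropy 0. If theta > 0 and B contains
   elements coprime to any given integer, a window of length n contains a set I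
   of at least theta n / 2 positions on which eta takes all 2^|I| values: start
   from a translate of I inside F_K and, modulo auxiliary coprime b_i in B
   without prime factors <= n, move it so that b_i kills position i; the other
   positions become coprime to b_i and stay free. Hence the entropy is positive.

   If gcd(b, b') > 1 for distinct b, b' in B, there is a finite admissible set
   meeting all nonzero classes mod b' and all classes mod b divisible by
   gcd(b, b'), and no translate of it is B-free; so X_eta = X_B forces
   coprimality. Proximality is equivalent, for nonempty B, to B having elements
   coprime to any given integer. *)

Require Import Defs.
From mathcomp Require Import all_boot all_order all_algebra.
From mathcomp Require Import all_classical all_reals all_analysis.
From mathcomp Require Import zify ring lra.

Set Implicit Arguments.
Unset Strict Implicit.
Unset Printing Implicit Defensive.

Import Order.TTheory GRing.Theory Num.Theory.
Import numFieldNormedType.Exports.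

Local Open Scope classical_set_scope.
Local Open Scope ring_scope.

(** * Periodic sets and logarithmic averages *)

Section PeriodicCounting.
Local Open Scope nat_scope.
Implicit Types (A : pred nat) (P Q : nat).

Definition cnt A P := \sum_(0 <= i < P) A i.

Definition periodic P A := forall i, A (i + P) = A i.

Lemma leq_cnt A1 A2 P : (forall i, A1 i -> A2 i) -> cnt A1 P <= cnt A2 P.
Proof. by move=> h; apply: leq_sum => i _; have := h i; case: (A1 i) => // ->. Qed.

Lemma eq_cnt A1 A2 P : A1 =1 A2 -> cnt A1 P = cnt A2 P.
Proof. by move=> h; apply: eq_bigr => i _; rewrite h. Qed.

Lemma cnt_add A P Q : cnt A (P + Q) = cnt A P + \sum_(0 <= i < Q) A (P + i).
Proof.
rewrite /cnt (big_cat_nat (n := P)) ?leq_addr//=; congr (_ + _).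
rewrite -{1}[P]add0n big_addn addKn.
by apply: eq_bigr => i _; rewrite addnC.
Qed.

Lemma cnt_mono A P Q : P <= Q -> cnt A P <= cnt A Q.
Proof. by move=> /subnKC <-; rewrite cnt_add leq_addr. Qed.

Lemma periodic_mul P A k i : periodic P A -> A (i + k * P) = A i.
Proof. by move=> pA; elim: k i => [|k IH] i; rewrite ?addn0// mulSn addnA IH pA. Qed.

Lemma periodic_mod P A i : periodic P A -> A (i %% P) = A i.
Proof. by move=> pA; rewrite {2}(divn_eq i P) addnC periodic_mul. Qed.

Lemma periodic_dvd P Q A : P %| Q -> periodic P A -> periodic Q A.
Proof. by move=> /dvdnP[k ->] pA i; rewrite periodic_mul. Qed.

Lemma cnt_mul P A k : periodic P A -> cnt A (k * P) = k * cnt A P.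
Proof.
move=> pA; elim: k => [|k IH]; first by rewrite /cnt big_geq.
rewrite mulSn addnC cnt_add IH mulSn addnC; congr (_ + _).
by apply: eq_bigr => i _; rewrite addnC periodic_mul.
Qed.

(** Sliding the window by one drops [A r] and gains [A (r + P)], which agree. *)
Lemma cnt_window P A r : periodic P A -> \sum_(0 <= i < P) A (r + i) = cnt A P.
Proof.
move=> pA; elim: r => [|r IH]; first by apply: eq_bigr.
rewrite -IH; case: P pA IH => [|P] pA _; first by rewrite !big_geq.
rewrite [LHS]big_nat_recr// [RHS]big_nat_recl// addn0 addSnnS pA addnC.
by congr (_ + _); apply: eq_bigr => i _; rewrite addSnnS.
Qed.

Lemma cnt_le_window P A r n : 0 < P -> periodic P A ->
  \sum_(0 <= i < n) A (r + i) <= (n %/ P).+1 * cnt A P.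
Proof.
move=> P0 pA; have pB : periodic P (fun i => A (r + i)).
  by move=> i; rewrite /= addnA pA.
apply: (@leq_trans (cnt (fun i => A (r + i)) ((n %/ P).+1 * P))).
  by apply: (@cnt_mono _ n); rewrite ltnW// ltn_ceil.
by rewrite cnt_mul// /cnt cnt_window.
Qed.

(** Each block of Q consecutive integers meets the class once, at [a %% Q + t * Q]. *)
Lemma cnt_class A Q a M : 0 < Q -> 
  cnt (fun j => A j && (j == a %[mod Q])) (M * Q) = cnt (fun t => A (a %% Q + t * Q)) M.
Proof.
move=> Q0; elim: M => [|M IH]; first by rewrite /cnt !big_geq.
rewrite mulSn addnC cnt_add IH /cnt [RHS]big_nat_recr//=; congr (_ + _).
rewrite (big_cat_nat (n := a %% Q)) ?(ltnW (ltn_pmod _ _))//=.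
rewrite big_nat_cond big1 ?add0n; last first.
  move=> i /andP[/andP[_ ia] _]; rewrite modnMDl modn_small; last first.
    exact: ltn_trans ia (ltn_pmod _ _).
  by rewrite ltn_eqF ?andbF.
rewrite big_ltn ?ltn_pmod// modnMDl modn_mod eqxx andbT big_nat_cond big1 ?addn0.
  by rewrite addnC.
move=> i /andP[/andP[ia iQ] _]; rewrite modnMDl modn_small//.
by rewrite gtn_eqF ?andbF.
Qed.

Lemma cnt_residue Q a P : 0 < Q -> Q %| P -> 
  cnt (fun j => j == a %[mod Q]) P = P %/ Q.
Proof.
move=> Q0 /dvdnP[k ->]; rewrite (@cnt_class predT)// mulnK//.
by rewrite /cnt /= sum_nat_const_nat subn0 muln1.
Qed.

(** As t runs over the residues modulo M, a + t Q permutes them, so the class modulo Q is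
    independent of A. *)
Lemma cnt_coprime_class A M Q a : 0 < M -> 0 < Q -> coprime M Q -> periodic M A ->
  cnt (fun j => A j && (j == a %[mod Q])) (M * Q) = cnt A M.
Proof.
move=> M0 Q0 cMQ pA; rewrite cnt_class// /cnt !big_mkord.
pose f (t : 'I_M) : 'I_M := Ordinal (ltn_pmod (a %% Q + t * Q) M0).
have finj : injective f.
  move=> t1 t2 /(congr1 val) /= /eqP; rewrite eqn_modDl => /eqP e.
  apply: val_inj; move: e => /=.
  wlog t12 : t1 t2 / t1 <= t2.
    move=> W e; case: (leqP t1 t2) => [/W|/ltnW/W]; first exact.
    by move=> /(_ (esym e)).
  move=> /esym/eqP; rewrite eqn_mod_dvd ?leq_mul2r ?t12 ?orbT// -mulnBl.
  rewrite Gauss_dvdl// => /dvdn_leq; case: (posnP (t2 - t1)) => [|_ /(_ isT)].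
    by move/eqP; rewrite subn_eq0 => t21 _; apply/eqP; rewrite eqn_leq t12.
  by rewrite leqNgt (leq_ltn_trans (leq_subr _ _)).
rewrite [RHS](reindex_inj finj)/=; apply: eq_bigr => t _.
by rewrite periodic_mod.
Qed.


End PeriodicCounting.

(** * Harris' inequality on divisor lattices *)

Section DivisorCorrelation.
Local Open Scope nat_scope.
Implicit Types (f g : nat -> nat) (F : pred nat).

(** Chebyshev's sum inequality: after doubling and pairing i with a - i, the difference consists of
    the nonnegative terms (f i - f (a - i)) (g i - g (a - i)). *)
Lemma chain_rearrangement f g a :
  (forall i j, i <= j -> f j <= f i) -> (forall i j, i <= j -> g j <= g i) ->
  \sum_(i < a.+1) f i * g (a - i) <= \sum_(i < a.+1) f i * g i.
Proof.
move=> fle gle; rewrite -leq_double -!addnn.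
rewrite {2}(reindex_inj rev_ord_inj) [X in _ <= _ + X](reindex_inj rev_ord_inj)/=.
rewrite -!big_split/=; apply: leq_sum => i _; rewrite !subSS.
have ia : i <= a by rewrite -ltnS.
rewrite subKn//; have [h|/ltnW h] := leqP i (a - i).
  by have := fle _ _ h; have := gle _ _ h; nia.
by have := fle _ _ h; have := gle _ _ h; nia.
Qed.

(** The divisor lattice of p^a v is a chain of a + 1 elements times the lattice of v; this allows
    induction over prime factors. *)
Lemma sum_divisors_pfactor p a v f : prime p -> 0 < v -> ~~ (p %| v) ->
  \sum_(d <- divisors (p ^ a * v)) f d =
  \sum_(i < a.+1) \sum_(d <- divisors v) f (p ^ i * d).
Proof.
move=> pp v0 pv; have p0 := prime_gt0 pp.
have u0 : 0 < p ^ a * v by rewrite muln_gt0 expn_gt0 p0.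
have npd d : d \in divisors v -> ~~ (p %| d).
  by rewrite -dvdn_divisors// => dv; apply: contra pv => /dvdn_trans; apply.
have cpd d : d \in divisors v -> forall k, coprime d (p ^ k).
  by move=> /npd dv k; rewrite coprime_sym coprimeXl// prime_coprime.
transitivity (\sum_(d <- [seq p ^ i * d | i <- index_iota 0 a.+1, d <- divisors v]) f d);
  last by rewrite big_allpairs_dep big_mkord.
apply/perm_big/uniq_perm; first exact: divisors_uniq.
  apply: allpairs_uniq; [exact: iota_uniq|exact: divisors_uniq|].
  move=> [i d] [j e] /allpairsP[[i' d'] [_ di [-> ->]]].
  move=> /allpairsP[[j' e'] [_ ej [-> ->]]] /= eq.
  have pos k x : x \in divisors v -> 0 < p ^ k * x.
    move=> /npd npx; rewrite muln_gt0 expn_gt0 p0/=.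
    by case: x npx => //; rewrite dvdn0.
  have lg k x : x \in divisors v -> logn p (p ^ k * x) = k.
    move=> xv; have := pos k x xv; rewrite muln_gt0 => /andP[pk x0].
    by rewrite lognM// pfactorK// (_ : logn p x = 0) ?addn0//
      logn_coprime// prime_coprime// npd.
  have ij : i' = j' by rewrite -(lg i' d')// -(lg j' e')// eq.
  move: eq; rewrite ij => /eqP; rewrite eqn_pmul2l ?expn_gt0 ?p0//.
  by move=> /eqP ->.
move=> x; rewrite -dvdn_divisors//; apply/idP/allpairsP => [xu|].
  have x0 : 0 < x by exact: dvdn_gt0 xu.
  have [m] := pfactor_coprime pp x0; rewrite mulnC => pm xe.
  exists (logn p x, m) => /=; split=> //.
    rewrite mem_index_iota/= ltnS -(pfactorK a pp).
    have -> : logn p (p ^ a) = logn p (p ^ a * v).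
      rewrite lognM ?expn_gt0 ?p0// [X in _ = _ + X]logn_coprime ?addn0//.
      by rewrite prime_coprime.
    exact: dvdn_leq_log.
  rewrite -dvdn_divisors// -(@Gauss_dvdr m (p ^ a)); last first.
    by rewrite coprime_sym coprimeXl.
  by apply: dvdn_trans xu; rewrite [X in _ %| X]xe dvdn_mull.
move=> [[i d] /= [ia dv ->]]; apply: dvdn_mul; last by rewrite dvdn_divisors.
by apply: dvdn_exp2l; rewrite mem_index_iota in ia.
Qed.

(* Harris' inequality on the divisor lattice of u, a product of chains: for
   decreasing f the pairing with a decreasing g dominates the pairing with
   the increasing function d |-> g (u / d). *)
Lemma divisor_correlation f g u : 0 < u ->
  (forall d e, 0 < e -> d %| e -> f e <= f d) ->
  (forall d e, 0 < e -> d %| e -> g e <= g d) ->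
  \sum_(d <- divisors u) f d * g (u %/ d) <= \sum_(d <- divisors u) f d * g d.
Proof.
elim/ltn_ind: u f g => u IH f g u0 fle gle.
have [u1|u1] := leqP u 1.
  have -> : u = 1 by apply/eqP; rewrite eqn_leq u1.
  by rewrite /divisors/= !big_seq1 divn1.
pose p := pdiv u; have pp : prime p by exact: pdiv_prime.
have p0 := prime_gt0 pp.
have [v pv ue] := pfactor_coprime pp u0; set a := logn p u in ue.
have v0 : 0 < v by move: u0; rewrite ue muln_gt0 => /andP[].
have a0 : 0 < a by rewrite logn_gt0 mem_primes pp u0 pdiv_dvd.
have vu : v < u.
  by rewrite ue -{1}[v]muln1 ltn_pmul2l// -{1}(expn0 p) ltn_exp2l// prime_gt1.
rewrite ue mulnC !sum_divisors_pfactor ?prime_coprime//;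
  try by rewrite -prime_coprime.
(* For fixed i the induction hypothesis on v turns v / d into d in the second factor; for fixed d
   the chain inequality then turns a - i into i. *)
apply: (@leq_trans (\sum_(i < a.+1) \sum_(d <- divisors v)
    f (p ^ i * d) * g (p ^ (a - i) * d))).
  apply: leq_sum => i _.
  have ia : i <= a by rewrite -ltnS.
  apply: leq_trans (IH v vu (fun d => f (p ^ i * d)) (fun d => g (p ^ (a - i) * d)) v0 _ _).
  - rewrite !big_seq; apply: leq_sum => d; rewrite -dvdn_divisors// => dv.
    have d0 : 0 < d by exact: dvdn_gt0 dv.
    rewrite leq_eqVlt; apply/orP; left; apply/eqP; congr (_ * g _).
    by rewrite -{1}(subnKC ia) expnD -mulnA divnMl ?expn_gt0 ?p0// muln_divA.
  - by move=> d e e0 de; apply: fle; rewrite ?muln_gt0 ?expn_gt0 ?p0// dvdn_mul.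
  - by move=> d e e0 de; apply: gle; rewrite ?muln_gt0 ?expn_gt0 ?p0// dvdn_mul.
rewrite exchange_big [leqRHS]exchange_big/=.
rewrite !big_seq; apply: leq_sum => d; rewrite -dvdn_divisors// => dv.
have d0 : 0 < d by exact: dvdn_gt0 dv.
apply: (@chain_rearrangement (fun i => f (p ^ i * d)) (fun i => g (p ^ i * d))) => i j ij.
  by apply: fle; rewrite ?muln_gt0 ?expn_gt0 ?p0 ?d0// dvdn_mul// dvdn_exp2l.
by apply: gle; rewrite ?muln_gt0 ?expn_gt0 ?p0 ?d0// dvdn_mul// dvdn_exp2l.
Qed.

Lemma sum_divisors_le u N f : 0 < u ->
  \sum_(d <- divisors u) (d <= N) * f d =
  \sum_(1 <= k < N.+1) (k %| u) * f k.
Proof.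
move=> u0; rewrite (eq_bigr (fun d => if d <= N then f d else 0)); last first.
  by move=> d _; case: ifP; rewrite ?mul1n.
rewrite -big_mkcond [RHS](eq_bigr (fun k => if k %| u then f k else 0)); last first.
  by move=> d _; case: ifP; rewrite ?mul1n.
rewrite -[RHS]big_mkcond -big_filter -[RHS]big_filter; apply/perm_big/uniq_perm.
- exact/filter_uniq/divisors_uniq.
- exact/filter_uniq/iota_uniq.
move=> d; rewrite !mem_filter -dvdn_divisors// mem_index_iota ltnS andbC.
by case: (boolP (d %| u)) => //= du; rewrite (dvdn_gt0 u0 du).
Qed.

Lemma sum_multiples k M f : 0 < k ->
  \sum_(1 <= u < (k * M).+1) (k %| u) * f (u %/ k) = \sum_(1 <= v < M.+1) f v.
Proof.
move=> k0; rewrite (eq_bigr (fun u => if k %| u then f (u %/ k) else 0)); last first.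
  by move=> d _; case: ifP; rewrite ?mul1n.
rewrite -big_mkcond -big_filter.
transitivity (\sum_(u <- [seq k * v | v <- index_iota 1 M.+1]) f (u %/ k)); last first.
  by rewrite big_map; apply: eq_bigr => v _; rewrite mulKn.
apply/perm_big/uniq_perm.
- exact/filter_uniq/iota_uniq.
- rewrite map_inj_uniq ?iota_uniq// => x y /eqP.
  by rewrite eqn_pmul2l// => /eqP.
move=> u; rewrite mem_filter mem_index_iota; apply/andP/mapP => [[ku uM]|[v vM ->]].
  exists (u %/ k); last by rewrite mulnC divnK.
  rewrite mem_index_iota divn_gt0// dvdn_leq//=; last by case/andP: uM.
  by rewrite ltn_divLR// mulnC; move/andP: uM => [_]; rewrite !ltnS mulnS; lia.
move: vM; rewrite mem_index_iota dvdn_mulr// !ltnS => /andP[v0 vM].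
by rewrite muln_gt0 k0 v0/= leq_mul2l vM orbT.
Qed.

(* [divisor_correlation] for f d = (d <= N) and g = F, summed over all u <= X. *)
Lemma divisor_closed_counting F L N X : 0 < L -> periodic L F ->
  (forall d e, 0 < e -> d %| e -> F e -> F d) ->
  (forall k, 0 < k <= N -> k * L %| X) ->
  \sum_(1 <= k < N.+1) X %/ (k * L) * cnt F L <=
  \sum_(1 <= k < N.+1) F k * (X %/ k).
Proof.
move=> L0 pF Fd kX.
have cntE k (h : nat -> nat) : 0 < k <= N ->
    \sum_(1 <= u < X.+1) (k %| u) * h (u %/ k) = \sum_(1 <= v < (X %/ k).+1) h v.
  move=> kN; have [k0 _] := andP kN.
  have kX' : k %| X by apply: dvdn_trans (kX k kN); exact: dvdn_mulr.
  by rewrite -{1}(divnK kX') mulnC sum_multiples.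
(* The multiples u = k v contribute [F v] for v up to X / k, a whole number of periods, so the count
   is exact. *)
have -> : \sum_(1 <= k < N.+1) X %/ (k * L) * cnt F L =
    \sum_(1 <= u < X.+1) \sum_(d <- divisors u) (d <= N) * F (u %/ d).
  rewrite [RHS]big_nat_cond.
  under [RHS]eq_bigr => u /andP[/andP[u0 _] _] do
    rewrite (sum_divisors_le N (fun d => F (u %/ d) : nat) u0).
  rewrite -[RHS]big_nat_cond exchange_big/= big_nat [RHS]big_nat.
  apply: eq_bigr => k; rewrite ltnS => kN.
  rewrite (cntE k (fun v => F v : nat))//.
  rewrite big_add1/=.
  have -> : X %/ k = X %/ (k * L) * L.
    have /dvdnP[q ->] := kX k kN; have [k0 _] := andP kN.
    by rewrite mulnK ?muln_gt0 ?k0// [k * L]mulnC mulnA mulnK.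
  rewrite -[RHS]/(cnt (fun i => F (1 + i)) _) cnt_mul; last first.
    by move=> i; rewrite /= addnA pF.
  by rewrite [in RHS]/cnt cnt_window.
have -> : \sum_(1 <= k < N.+1) F k * (X %/ k) =
    \sum_(1 <= u < X.+1) \sum_(d <- divisors u) (d <= N) * F d.
  rewrite [RHS]big_nat_cond.
  under [RHS]eq_bigr => u /andP[/andP[u0 _] _] do
    rewrite (sum_divisors_le N (fun d => F d : nat) u0).
  rewrite -[RHS]big_nat_cond exchange_big/= big_nat [RHS]big_nat.
  apply: eq_bigr => k; rewrite ltnS => kN.
  rewrite (cntE k (fun=> F k : nat))// sum_nat_const_nat subn1/= mulnC//.
rewrite big_nat_cond [leqRHS]big_nat_cond; apply: leq_sum => u /andP[/andP[u0 _] _].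
apply: (@divisor_correlation (fun d => d <= N : nat) (fun d => F d : nat)) => //.
- move=> d e e0 /dvdn_leq de /=; have {}de := de e0.
  by case: (leqP e N) => // eN; rewrite (leq_trans de eN).
- by move=> d e e0 de; have := Fd _ _ e0 de; case: (F e) => // ->.
Qed.

End DivisorCorrelation.

(** * Logarithmic sums of periodic sets *)

Section LogarithmicAverages.
Variable R : realType.
Implicit Types (A F : pred nat) (P L N T : nat).

Definition dens A P : R := (cnt A P)%:R / P%:R.

Definition logsum A N : R := \sum_(1 <= m < N.+1) (A m)%:R / m%:R.

Definition harm N : R := logsum predT N.

Lemma dens_ge0 A P : 0 <= dens A P.
Proof. by rewrite divr_ge0. Qed.

Lemma dens_mul A P k : (0 < k)%N -> periodic P A -> dens A (k * P) = dens A P.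
Proof.
move=> k0 pA; rewrite /dens cnt_mul// !natrM -mulf_div divff ?mul1r//.
by rewrite pnatr_eq0 -lt0n.
Qed.

Lemma dens_eq A P Q : (0 < P)%N -> (0 < Q)%N -> periodic P A -> periodic Q A ->
  dens A P = dens A Q.
Proof. by move=> P0 Q0 pP pQ; rewrite -(dens_mul Q0 pP) mulnC dens_mul. Qed.

Lemma dens_dvd A P Q : (0 < Q)%N -> (P %| Q)%N -> periodic P A ->
  dens A P = dens A Q.
Proof.
move=> Q0 PQ pP; apply: dens_eq => //; first exact: dvdn_gt0 PQ.
exact: periodic_dvd pP.
Qed.

Lemma ler_dens A1 A2 P : (forall i, A1 i -> A2 i) -> dens A1 P <= dens A2 P.
Proof. by move=> h; rewrite /dens ler_wpM2r ?invr_ge0// ler_nat leq_cnt. Qed.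

Lemma logsum_ge0 A N : 0 <= logsum A N.
Proof. by apply: sumr_ge0 => m _; rewrite divr_ge0. Qed.

Lemma logsum_addn A M N : logsum A (M + N) =
  logsum A M + \sum_(1 <= i < N.+1) (A (M + i)%N)%:R / (M + i)%:R.
Proof.
rewrite /logsum (big_cat_nat (n := M.+1)) ?ltnS ?leq_addr//=; congr (_ + _).
rewrite -{1}[M.+1]addn1 addnC big_addn subSn ?leq_addr// addKn.
by apply: eq_bigr => i _; rewrite addnC.
Qed.

Lemma logsum_mono A M N : (M <= N)%N -> logsum A M <= logsum A N.
Proof.
by move=> /subnKC <-; rewrite logsum_addn lerDl sumr_ge0.
Qed.

Lemma logsum_window A P k : periodic P A -> (0 < P)%N ->
  \sum_(1 <= i < P.+1) (A (P * k + i)%N)%:R = (cnt A P)%:R :> R.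
Proof.
move=> pA P0; rewrite -natr_sum big_add1/=.
under eq_bigr do rewrite -addSnnS.
by rewrite cnt_window.
Qed.

Lemma harmS T : harm T.+1 = harm T + T.+1%:R^-1.
Proof. by rewrite -addn1 /harm logsum_addn big_nat1/= mul1r. Qed.

(** The block after P T holds [cnt A P] elements of A, each of weight at least 1 / (P (T + 1)). *)
Lemma logsum_ge A P T : (0 < P)%N -> periodic P A ->
  dens A P * harm T <= logsum A (P * T).
Proof.
move=> P0 pA; elim: T => [|T IH].
  by rewrite muln0 /harm /logsum !big_geq// mulr0.
rewrite mulnS [(P + _)%N]addnC logsum_addn harmS mulrDr.
apply: lerD => //; rewrite /dens -(logsum_window T pA P0).
rewrite !mulr_suml !big_nat.
apply: ler_sum => i /andP[i0 iP]; rewrite -!mulrA ler_wpM2l//.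
rewrite -invfM -natrM lef_pV2 ?posrE ?ltr0n ?muln_gt0 ?P0 ?addn_gt0 ?i0 ?orbT//.
by rewrite ler_nat; lia.
Qed.

(** The first block costs at most L, bounding its weights by 1; in the block after L k, for k > 0,
    the weights are at most 1 / (L k). *)
Lemma logsum_le A L N : (0 < L)%N -> periodic L A ->
  logsum A N <= L%:R + dens A L * harm (N %/ L).
Proof.
move=> L0 pA; apply: (@le_trans _ _ (logsum A (L * (N %/ L).+1))).
  by apply: logsum_mono; rewrite mulnC ltnW// ltn_ceil.
elim: (N %/ L)%N => {N} [|k IH].
  rewrite muln1 /harm {2}/logsum big_geq// mulr0 addr0.
  have <- : \sum_(1 <= m < L.+1) (1 : R) = L%:R by rewrite sumr_const_nat subn1.
  rewrite /logsum !big_nat ler_sum// => i /andP[i0 _].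
  by case: (A i); rewrite ?mul0r// mul1r invf_le1 ?ler1n ?ltr0n.
rewrite mulnS [(L + _)%N]addnC logsum_addn harmS mulrDr addrA.
apply: lerD => //; rewrite /dens -(logsum_window k.+1 pA L0).
rewrite !mulr_suml !big_nat; apply: ler_sum => i /andP[i0 iL].
rewrite -!mulrA ler_wpM2l// -invfM -natrM.
rewrite lef_pV2 ?posrE ?ltr0n ?muln_gt0 ?L0 ?addn_gt0 ?i0 ?orbT//.
by rewrite ler_nat; lia.
Qed.

Lemma harm_mul k T : (0 < k)%N -> harm (k * T) <= k%:R + harm T.
Proof.
move=> k0; have := @logsum_le predT k (k * T) k0 (fun=> erefl).
rewrite mulKn// (_ : dens predT k = 1) ?mul1r//.
rewrite /dens /cnt/= sum_nat_const_nat subn0 muln1 divff//.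
by rewrite pnatr_eq0 -lt0n.
Qed.

(** Oresme's argument: the terms after 2^k up to 2^(k+1) add at least 1/2. *)
Lemma harm_unbounded (C : R) : exists T, C < harm T.
Proof.
have h k : (k%:R / 2 : R) <= harm (2 ^ k).
  elim: k => [|k IH]; first by rewrite mul0r logsum_ge0.
  rewrite expnS mul2n -addnn /harm logsum_addn -addn1 natrD mulrDl lerD//.
  rewrite mul1r; apply: (@le_trans _ _ (\sum_(1 <= i < (2 ^ k).+1) (2 ^ k.+1)%:R^-1)).
    rewrite sumr_const_nat subn1/= -[leRHS]mulr_natl expnS natrM invfM mulrCA.
    by rewrite divff ?mulr1// pnatr_eq0 -lt0n expn_gt0.
  rewrite !big_nat; apply: ler_sum => i /andP[i0 ik] /=; rewrite mul1r.
  rewrite lef_pV2 ?posrE ?ltr0n ?expn_gt0 ?addn_gt0 ?i0 ?orbT//.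
  by rewrite ler_nat expnS mul2n -addnn leq_add2l -ltnS.
exists (2 ^ (Num.bound `|C * 2|%R))%N; apply: lt_le_trans (h _).
rewrite ltr_pdivlMr//; apply: le_lt_trans (ler_norm _) _.
exact: archi_boundP.
Qed.

(** This is [divisor_closed_counting] divided by X = N! L, a choice that makes all its quotients
    exact. *)
Lemma divisor_closed_dens_le F L N : (0 < L)%N -> periodic L F ->
  (forall d e, (0 < e)%N -> (d %| e)%N -> F e -> F d) ->
  dens F L * harm N <= logsum F N.
Proof.
move=> L0 pF Fd; set X := (N`! * L)%N.
have X0 : (0 < X%:R :> R) by rewrite ltr0n muln_gt0 fact_gt0.
have kX k : (0 < k <= N)%N -> (k * L %| X)%N.
  by move=> /dvdn_fact kN; rewrite dvdn_mul.
have := divisor_closed_counting L0 pF Fd kX.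
rewrite -(ler_nat R) !natr_sum => h; rewrite -(ler_pM2l X0).
have L0' : L%:R != 0 :> R by rewrite pnatr_eq0 -lt0n.
move: h; congr (_ <= _).
  rewrite /dens /harm /logsum !mulr_sumr !big_nat; apply: eq_bigr => k /andP[k0 kN].
  rewrite natrM natf_div ?kX ?k0// natrM/=.
  have k0' : k%:R != 0 :> R by rewrite pnatr_eq0 -lt0n.
  by field; rewrite k0' L0'.
rewrite /logsum mulr_sumr !big_nat; apply: eq_bigr => k /andP[k0 kN].
rewrite natrM natf_div; last by apply: dvdn_trans (kX k _); rewrite ?dvdn_mulr// k0.
have k0' : k%:R != 0 :> R by rewrite pnatr_eq0 -lt0n.
by field.
Qed.

End LogarithmicAverages.

(** * Densities of B-free numbers *)

Section SieveDensities.
Variables (R : realType) (B : set nat).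
Hypothesis B_gt1 : forall b, B b -> (1 < b)%N.
Implicit Types (s : seq nat) (K N P w : nat).

Definition free_of s : pred nat := fun n => all (fun b => ~~ (b %| n)%N) s.

Definition Bseq K : seq nat := [seq b <- iota 1 K | `[< B b >]].

Definition freeK K : pred nat := free_of (Bseq K).

Definition freeB : pred nat := fun n => `[< forall b, B b -> ~~ (b %| n)%N >].

Definition dK K : R := dens R (freeK K) K`!.

(* By Davenport-Erdos, the logarithmic density of the B-free numbers. *)
Definition theta : R := inf (range dK).

Lemma mem_Bseq K b : (b \in Bseq K) = `[< B b >] && (b <= K)%N.
Proof.
rewrite mem_filter mem_iota add1n ltnS; case: asboolP => //= /B_gt1/ltnW b1.
by rewrite b1.
Qed.

Lemma Bseq_uniq K : uniq (Bseq K).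
Proof. by rewrite filter_uniq// iota_uniq. Qed.

Lemma free_ofP s n : reflect (forall b, b \in s -> ~~ (b %| n)%N) (free_of s n).
Proof. exact: allP. Qed.

Lemma free_of_dvd s d e : (d %| e)%N -> free_of s e -> free_of s d.
Proof.
move=> de /free_ofP h; apply/free_ofP => b /h; apply: contra => /dvdn_trans; exact.
Qed.

Lemma periodic_free_of s P : (forall b, b \in s -> (b %| P)%N) ->
  periodic P (free_of s).
Proof.
move=> sP n; apply: eq_in_all => b /sP bP; rewrite dvdn_addl//.
Qed.

Lemma Bseq_dvd_fact K b : b \in Bseq K -> (b %| K`!)%N.
Proof.
rewrite mem_Bseq => /andP[/asboolP/B_gt1/ltnW b0 bK].
by rewrite dvdn_fact// b0.
Qed.

Lemma freeK_periodic K : periodic K`! (freeK K).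
Proof. exact/periodic_free_of/Bseq_dvd_fact. Qed.

Lemma freeBP n : reflect (forall b, B b -> ~~ (b %| n)%N) (freeB n).
Proof. exact: asboolP. Qed.

Lemma freeB_freeK K n : freeB n -> freeK K n.
Proof.
by move=> /freeBP h; apply/free_ofP => b; rewrite mem_Bseq => /andP[/asboolP/h].
Qed.

Lemma freeK_freeB K n : (0 < n <= K)%N -> freeK K n -> freeB n.
Proof.
move=> /andP[n0 nK] /free_ofP h; apply/freeBP => b Bb; apply/negP => bn.
have := h b; rewrite mem_Bseq bn; move/asboolP: (Bb) => -> /=.
by rewrite (leq_trans (dvdn_leq n0 bn) nK) => /(_ isT).
Qed.

Lemma freeK_mono K K' n : (K <= K')%N -> freeK K' n -> freeK K n.
Proof.
move=> KK /free_ofP h; apply/free_ofP => b; rewrite mem_Bseq => /andP[Bb bK].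
by apply: h; rewrite mem_Bseq Bb (leq_trans bK).
Qed.

Lemma dK_ge0 K : 0 <= dK K.
Proof. exact: dens_ge0. Qed.

Lemma dK_le K K' : (K <= K')%N -> dK K' <= dK K.
Proof.
move=> KK; have KKf : (K`! %| K'`!)%N.
  by rewrite -(bin_fact KK) dvdn_mull// dvdn_mulr.
rewrite /dK (dens_dvd _ (fact_gt0 K') KKf (@freeK_periodic K)).
by apply: ler_dens => i; exact: freeK_mono.
Qed.

Lemma has_inf_dK : has_inf (range dK).
Proof. by split; [exists (dK 0%N), 0%N|exists 0 => _ [K _ <-]; exact: dK_ge0]. Qed.

Lemma theta_le K : theta <= dK K.
Proof. by apply: ge_inf; [exact: has_inf_dK.2|exists K]. Qed.

Lemma theta_approx (e : R) : 0 < e -> exists K, forall K', (K <= K')%N -> dK K' < theta + e.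
Proof.
move=> e0; have [_ [K _ <-] h] := inf_adherent e0 has_inf_dK.
by exists K => K' /dK_le /le_lt_trans; apply.
Qed.

(** Up to N, being B-free and being free of B up to N coincide, and the latter condition is
    periodic, closed under divisors and of density [dK N]. *)
Lemma logsum_freeB_ge N : theta * harm R N <= logsum R freeB N.
Proof.
apply: (@le_trans _ _ (dK N * harm R N)).
  by rewrite ler_wpM2r ?logsum_ge0 ?theta_le.
have -> : logsum R freeB N = logsum R (freeK N) N.
  rewrite /logsum !big_nat; apply: eq_bigr => i /andP[i0 iN].
  suff -> : freeB i = freeK N i by [].
  by apply/idP/idP => [/freeB_freeK|/freeK_freeB]; apply; rewrite ?i0.
apply: divisor_closed_dens_le; first exact: fact_gt0.
  exact: freeK_periodic.
by move=> d e _; exact: free_of_dvd.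
Qed.

Lemma logsum_freeK_le K N : logsum R (freeK K) N <= K`!%:R + dK K * harm R N.
Proof.
apply: le_trans (logsum_le _ _ (fact_gt0 K) (@freeK_periodic K)) _.
by rewrite lerD2l ler_wpM2l ?dK_ge0// logsum_mono// leq_div.
Qed.

Let excess K : pred nat := fun n => freeK K n && ~~ freeB n.

Let logsum_excess K N :
  logsum R (excess K) N <= K`!%:R + (dK K - theta) * harm R N.
Proof.
have -> : logsum R (excess K) N = logsum R (freeK K) N - logsum R freeB N.
  rewrite /logsum -sumrB; apply: eq_bigr => i _; rewrite -mulrBl /excess.
  case: (boolP (freeB i)) => [/(@freeB_freeK K) ->|_]; first by rewrite subrr.
  by rewrite andbT subr0.
rewrite mulrBl addrA lerB ?logsum_freeK_le//; exact: logsum_freeB_ge.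
Qed.

(* Davenport-Erdos: in logarithmic average almost no integer is free of
   B /\ [1, K] without being B-free, once K is large. *)
Lemma freeB_of_freeK w (g : R) : 0 < g -> exists K, forall K', (K <= K')%N ->
  forall P (G I : pred nat), (0 < P)%N -> periodic P G -> g <= dens R G P ->
  (forall j i, G j -> I i -> (i < w)%N -> freeK K' (j + i)%N) ->
  exists j, G j /\ forall i, I i -> (i < w)%N -> freeB (j + i)%N.
Proof.
move=> g0; have w2 : 0 < (2 * (w * w).+1)%:R :> R by rewrite ltr0n.
(* Chosen so that w^2 e <= g / 2; one factor w counts the shifts, the other is the loss of weight in
   each shift. *)
pose e := g / (2 * (w * w).+1)%:R.
have e0 : 0 < e by rewrite divr_gt0.
have [K hK] := theta_approx e0.
exists K => K' KK P G I P0 pG gG GI; apply: contrapT => /forallNP noj.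
have dK' : dK K' - theta <= e by rewrite lerBlDl ltW// hK.
(* Since j + i <= w j for j >= 1 and i < w, replacing the weight 1 / j by 1 / (j + i) loses at most
   a factor w. *)
have shift i N : (i < w)%N ->
    \sum_(1 <= j < N.+1) (excess K' (j + i)%N)%:R / j%:R <= w%:R * logsum R (excess K') (N + w).
  move=> iw; apply: (@le_trans _ _ (w%:R * logsum R (excess K') (i + N))); last first.
    by rewrite ler_wpM2l// logsum_mono// addnC leq_add2l ltnW.
  rewrite logsum_addn mulrDr; apply: ler_wpDl; first by rewrite mulr_ge0// logsum_ge0.
  rewrite mulr_sumr !big_nat; apply: ler_sum => j /andP[j0 _].
  rewrite addnC mulrCA ler_wpM2l// ler_pdivlMr ?ltr0n ?addn_gt0 ?j0 ?orbT//.
  rewrite mulrC ler_pdivrMr ?ltr0n// -natrM ler_nat; nia.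
(* If the conclusion fails, each j in G has some j + i in [excess], so G is covered by w translates
   of that set. *)
have GN N : logsum R G N <= (w * w)%:R * logsum R (excess K') (N + w).
  apply: (@le_trans _ _ (\sum_(1 <= j < N.+1) \sum_(i < w) (excess K' (j + i)%N)%:R / j%:R)).
    rewrite /logsum !big_nat; apply: ler_sum => j /andP[j0 _].
    rewrite -mulr_suml ler_wpM2r ?invr_ge0//.
    case: (boolP (G j)) => [Gj|_]; last by rewrite sumr_ge0.
    have [i Di] : exists i : 'I_w, excess K' (j + i)%N.
      apply: contrapT => /forallNP h; apply: (noj j); split=> // i Ii iw.
      have := h (Ordinal iw); rewrite /excess/= GI//= => /negP.
      by rewrite negbK.
    by rewrite (bigD1 i)//= Di lerDl sumr_ge0.
  rewrite exchange_big/=.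
  apply: (@le_trans _ _ (\sum_(i < w) w%:R * logsum R (excess K') (N + w))).
    by apply: ler_sum => i _; exact: shift.
  by rewrite sumr_const card_ord -[leLHS]mulr_natl mulrA natrM.
pose C := K'`!%:R + e * (P + w)%:R.
have C0 : 0 <= C by rewrite addr_ge0// mulr_ge0// ltW.
(* T makes (g / 2) [harm T] exceed w^2 C, contradicting the bound obtained below. *)
have [T hT] := harm_unbounded ((w * w)%:R * C * 2 / g).
have T0 : (0 < T)%N.
  rewrite lt0n; apply/eqP => T0; move: hT; rewrite T0 /harm /logsum big_geq//.
  by rewrite ltNge divr_ge0// ?mulr_ge0// ltW.
have hharm : harm R (P * T + w) <= (P + w)%:R + harm R T.
  apply: le_trans (harm_mul R T _); last by rewrite addn_gt0 P0.
  by rewrite logsum_mono//; nia.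
have h0 : 0 <= harm R T by exact: logsum_ge0.
have : g * harm R T <= (w * w)%:R * C + g / 2 * harm R T.
  apply: (@le_trans _ _ (dens R G P * harm R T)); first by rewrite ler_wpM2r.
  apply: (le_trans (logsum_ge _ T P0 pG)); apply: le_trans (GN _) _.
  apply: (@le_trans _ _ ((w * w)%:R * (C + e * harm R T))).
    rewrite ler_wpM2l//; apply: le_trans (logsum_excess _ _) _.
    rewrite /C -addrA lerD2l -mulrDr.
    apply: (@le_trans _ _ (e * harm R (P * T + w))); first by rewrite ler_wpM2r ?logsum_ge0.
    by rewrite ler_wpM2l// ltW.
  rewrite mulrDr lerD2l mulrA; apply: ler_wpM2r => //.
  rewrite /e mulrA ler_pdivrMr// [(2 * _)%:R]natrM mulrA divfK ?pnatr_eq0//.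
  by rewrite mulrC ler_wpM2l ?ltW// ltr_nat.
move: hT; rewrite ltr_pdivrMr//; nra.
Qed.

Lemma theta_gt0P : (forall e : R, 0 < e -> exists K, dK K < e) \/ 0 < theta.
Proof.
have [t0|t0] := ltP 0 theta; [by right|left=> e /theta_approx[K /(_ _ (leqnn K)) h]].
by exists K; apply: lt_le_trans h _; rewrite gerDr.
Qed.

End SieveDensities.

(** * Chinese remainders and pairwise coprime families *)

Section CoprimeFamilies.
Local Open Scope nat_scope.

Lemma coprime_prodr (I : eqType) (s : seq I) (q : I -> nat) b :
  (forall i, i \in s -> coprime b (q i)) -> coprime b (\prod_(i <- s) q i).
Proof.
elim: s => [|i s IH] h; first by rewrite big_nil coprimen1.
rewrite big_cons coprimeMr h ?mem_head//= IH// => j js.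
by rewrite h// in_cons js orbT.
Qed.

Lemma dvdn_prod_seq (I : eqType) (s : seq I) (q : I -> nat) i :
  i \in s -> q i %| \prod_(i <- s) q i.
Proof.
move=> si; rewrite (perm_big _ (perm_to_rem si)) big_cons; exact: dvdn_mulr.
Qed.

(** The system a = - r i modulo q i, written without subtraction, is solved by adding one modulus at
    a time to the product of the others. *)
Lemma chinese_seq (I : eqType) (s : seq I) (q r : I -> nat) : uniq s ->
  (forall i, i \in s -> 0 < q i) ->
  {in s &, forall i j, i != j -> coprime (q i) (q j)} ->
  exists a, forall i, i \in s -> q i %| a + r i.
Proof.
elim: s => [|i s IH]; first by exists 0.
move=> /= /andP[si us] q0 cq.
have [|k ks|j k js ks|a ha] := IH; [by []|by rewrite q0// in_cons ks orbT| |].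
  by apply: cq; rewrite in_cons ?js ?ks orbT.
have cQ : coprime (q i) (\prod_(j <- s) q j).
  apply: coprime_prodr => j js; apply: cq; rewrite ?mem_head ?in_cons ?js ?orbT//.
  by apply: contraNneq si => ->.
pose b := q i - r i %% q i.
have bi : q i %| b + r i.
  rewrite [X in _ + X](divn_eq (r i) (q i)) addnCA subnK ?dvdn_addl ?dvdn_mull//.
  by rewrite ltnW// ltn_pmod// q0// mem_head.
exists (chinese (q i) (\prod_(j <- s) q j) b a) => j.
rewrite in_cons => /predU1P[->|js].
  by rewrite /dvdn -modnDml chinese_modl// modnDml.
have jQ : q j %| \prod_(j <- s) q j by exact: dvdn_prod_seq.
rewrite /dvdn -modnDml -(modn_dvdm (chinese _ _ _ _) jQ) chinese_modr// modn_dvdm// modnDml.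
exact: ha.
Qed.

(** The arithmetic counterpart of proximality for nonempty B. *)
Definition rich (B : set nat) := forall m, 0 < m -> exists2 b, B b & coprime b m.

(** Greedy choice: the next element is taken coprime to m times the product of the previous ones. *)
Lemma rich_family (B : set nat) n m : (forall b, B b -> 1 < b) ->
  rich B -> 0 < m -> exists f : nat -> nat,
  [/\ forall i, i < n -> B (f i), forall i, i < n -> coprime (f i) m &
    forall i j, i < n -> j < n -> i != j -> coprime (f i) (f j)].
Proof.
move=> B1 rB m0; elim: n => [|n [f [fB fm fc]]]; first by exists id.
have [|b Bb] := rB (m * \prod_(i <- iota 0 n) f i).
  rewrite muln_gt0 m0/= big_seq; apply: prodn_cond_gt0 => i.
  by rewrite mem_iota => /andP[_ /fB/B1]; apply: ltn_trans.
rewrite coprimeMr => /andP[bm bf].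
have bfi i : i < n -> coprime b (f i).
  move=> i_n; apply: coprime_dvdr bf; apply: dvdn_prod_seq.
  by rewrite mem_iota.
exists (fun i => if i == n then b else f i); split.
- by move=> i; rewrite ltnS leq_eqVlt; case: eqP => //= _ /fB.
- by move=> i; rewrite ltnS leq_eqVlt; case: eqP => //= _ /fm.
- move=> i j; rewrite (ltnS i) (ltnS j) (leq_eqVlt i) (leq_eqVlt j).
  case: (eqVneq i n) => [->|_]; case: (eqVneq j n) => [->|_] //=.
  + by move=> _ jn _; exact: bfi.
  + by move=> i_n _ _; rewrite coprime_sym bfi.
  + exact: fc.
Qed.

End CoprimeFamilies.

(** * Densities for pairwise coprime moduli *)

Section ProductFormula.
Variable R : realType.
Implicit Types s : seq nat.

Definition coprime_seq s := {in s &, forall a b, a != b -> coprime a b}.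

(** A modulus b coprime to the earlier product removes exactly the fraction 1 / b of what is
    left. *)
Lemma dens_free_of s : uniq s -> coprime_seq s -> (forall b, b \in s -> (0 < b)%N) ->
  dens R (free_of s) (\prod_(b <- s) b)%N = \prod_(b <- s) (1 - b%:R^-1).
Proof.
elim: s => [_ _ _|b s IH].
  by rewrite !big_nil /dens /cnt big_nat1 /= divr1.
move=> /= /andP[bs us] cs s0.
have b0 : (0 < b)%N by rewrite s0 ?mem_head.
have s0' c : c \in s -> (0 < c)%N by move=> cs'; rewrite s0// in_cons cs' orbT.
have P0 : (0 < \prod_(b <- s) b)%N by rewrite big_seq prodn_cond_gt0.
set P := (\prod_(b <- s) b)%N in IH P0 *.
have cs' : coprime_seq s.
  by move=> c d cs1 ds1; apply: cs; rewrite in_cons ?cs1 ?ds1 orbT.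
have cPb : coprime P b.
  rewrite coprime_sym coprime_prodr// => c cs1; apply: cs.
  - exact: mem_head.
  - by rewrite in_cons cs1 orbT.
  - by apply: contraNneq bs => ->.
have pP : periodic P (free_of s) by apply: periodic_free_of => c; exact: dvdn_prod_seq.
rewrite !big_cons -IH// -/P mulnC /dens.
have -> : cnt (free_of (b :: s)) (P * b) =
    (cnt (free_of s) (P * b) - cnt (fun j => free_of s j && (j == 0 %[mod b])) (P * b))%N.
  rewrite /cnt -sumnB => [|i _]; last by case: (free_of s i) => //; case: (_ == _).
  apply: eq_bigr => i _; rewrite /free_of/= mod0n -/(dvdn b i).
  by case: (b %| i)%N; case: (all _ s).
rewrite cnt_coprime_class// mulnC cnt_mul// natrB ?leq_pmull// !natrM.
have bR : b%:R != 0 :> R by rewrite pnatr_eq0 -lt0n.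
have PR : P%:R != 0 :> R by rewrite pnatr_eq0 -lt0n.
by field; rewrite bR PR.
Qed.

(** The induction rests on (1 - x) (1 + x + S) <= 1 + S. A positive lower bound on the product thus
    bounds the sum of reciprocals. *)
Lemma prod_one_sub_le s : (forall b, b \in s -> (0 < b)%N) ->
  0 <= \prod_(b <- s) (1 - b%:R^-1 : R) /\
  \prod_(b <- s) (1 - b%:R^-1 : R) * (1 + \sum_(b <- s) b%:R^-1) <= 1.
Proof.
elim: s => [_|b s IH s0]; first by rewrite !big_nil addr0 mulr1.
have [|p0 p1] := IH; first by move=> c cs; rewrite s0// in_cons cs orbT.
have b0 : (0 < b)%N by rewrite s0 ?mem_head.
have x0 : 0 <= b%:R^-1 :> R by rewrite invr_ge0.
have x1 : b%:R^-1 <= 1 :> R by rewrite invf_le1 ?ler1n ?ltr0n.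
rewrite !big_cons; set x := _^-1 in x0 x1 *; move: p0 p1.
set p := \prod_(_ <- _) _; set S := \sum_(_ <- _) _ => p0 p1.
have S0 : 0 <= S by apply: sumr_ge0 => i _; rewrite invr_ge0.
split; first by rewrite mulr_ge0// subr_ge0.
apply: le_trans p1; rewrite mulrC mulrA mulrC ler_wpM2l//; nra.
Qed.

(** Weierstrass' product inequality. *)
Lemma prod_one_sub_ge s : (forall b, b \in s -> (0 < b)%N) ->
  1 - \sum_(b <- s) b%:R^-1 <= \prod_(b <- s) (1 - b%:R^-1 : R) <= 1.
Proof.
elim: s => [_|b s IH s0]; first by rewrite !big_nil subr0 !lexx.
have /andP[IH1 IH2] : 1 - \sum_(b <- s) b%:R^-1 <= \prod_(b <- s) (1 - b%:R^-1 : R) <= 1.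
  by apply: IH => c cs; rewrite s0// in_cons cs orbT.
have b0 : (0 < b)%N by rewrite s0 ?mem_head.
have x0 : 0 <= b%:R^-1 :> R by rewrite invr_ge0.
have x1 : b%:R^-1 <= 1 :> R by rewrite invf_le1 ?ler1n ?ltr0n.
have p0 : 0 <= \prod_(b <- s) (1 - b%:R^-1 : R).
  by apply: (prod_one_sub_le _).1 => c cs; rewrite s0// in_cons cs orbT.
rewrite !big_cons; apply/andP; split; nra.
Qed.

End ProductFormula.

Section CoprimeSets.
Variables (R : realType) (B : set nat).
Hypothesis B_gt1 : forall b, B b -> (1 < b)%N.
Hypothesis B_cop : forall a b, B a -> B b -> a != b -> coprime a b.

Lemma Bseq_B K b : b \in Bseq B K -> B b.
Proof. by rewrite mem_Bseq// => /andP[/asboolP]. Qed.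

Lemma Bseq_gt0 K b : b \in Bseq B K -> (0 < b)%N.
Proof. by move=> /Bseq_B/B_gt1/ltnW. Qed.

Lemma Bseq_coprime K : coprime_seq (Bseq B K).
Proof. by move=> a b /Bseq_B Ba /Bseq_B Bb; exact: B_cop. Qed.

Lemma dK_prod K : dK R B K = \prod_(b <- Bseq B K) (1 - b%:R^-1).
Proof.
rewrite -dens_free_of; [|exact: Bseq_uniq|exact: Bseq_coprime|exact: Bseq_gt0].
apply: dens_eq; rewrite ?fact_gt0//.
- by rewrite big_seq prodn_cond_gt0// => b; exact: Bseq_gt0.
- exact: freeK_periodic.
- by apply: periodic_free_of => b; exact: dvdn_prod_seq.
Qed.

Lemma sum_inv_le K : 0 < theta R B ->
  \sum_(b <- Bseq B K) (b%:R^-1 : R) <= (theta R B)^-1.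
Proof.
move=> t0; have [p0 p1] := prod_one_sub_le R (@Bseq_gt0 K).
have := theta_le R B K; rewrite dK_prod => tK.
rewrite -[leRHS]mul1r ler_pdivlMr// mulrC; apply: le_trans p1.
apply: (@le_trans _ _ (theta R B * (1 + \sum_(b <- Bseq B K) b%:R^-1))).
  by rewrite ler_wpM2l ?(ltW t0)// lerDr.
by rewrite ler_wpM2r// addr_ge0// sumr_ge0// => i _; rewrite invr_ge0.
Qed.

Lemma Bseq_cat M K : (M <= K)%N ->
  Bseq B K = Bseq B M ++ [seq b <- iota M.+1 (K - M) | `[< B b >]].
Proof.
by move=> MK; rewrite /Bseq -{1}(subnKC MK) iotaD filter_cat add1n.
Qed.

(** The sums run over B in ]M, K], uniformly in K; for K <= M they are empty by truncated
    subtraction. *)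
Definition summable_tail M (e : R) := forall K,
  \sum_(b <- [seq b <- iota M.+1 (K - M) | `[< B b >]]) (b%:R^-1 : R) <= e.

(** The factors up to M have a positive product, and by Weierstrass' inequality those beyond M
    multiply to at least 1/2. *)
Lemma theta_gt0_summable M : summable_tail M 2^-1 -> 0 < theta R B.
Proof.
move=> tail.
have prod_gt0 : 0 < dK R B M.
  rewrite dK_prod big_seq prodr_gt0// => b /Bseq_B/B_gt1 b1.
  by rewrite subr_gt0 invf_lt1 ?ltr1n// ltr0n ltnW.
apply: (@lt_le_trans _ _ (dK R B M / 2)); first by rewrite divr_gt0.
apply: lb_le_inf; first by exists (dK R B 0), 0%N.
move=> _ [K _ <-]; have [KM|/ltnW MK] := leqP K M.
  apply: le_trans (dK_le R B_gt1 KM); move: prod_gt0; lra.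
rewrite !dK_prod (Bseq_cat MK) big_cat/= ler_wpM2l//; first by rewrite -dK_prod ltW.
set s' := [seq b <- iota _ _ | _].
have s'0 b : b \in s' -> (0 < b)%N.
  by rewrite mem_filter mem_iota => /andP[_ /andP[+ _]]; case: b.
have /andP[p _] := prod_one_sub_ge R s'0.
apply: le_trans p; by have := tail K; rewrite -/s'; lra.
Qed.

End CoprimeSets.

(** * Occurrence of patterns *)

Lemma cnt_two_residues (Q b a c P : nat) : (0 < Q)%N -> (0 < b)%N -> coprime Q b ->
  (Q * b %| P)%N ->
  cnt (fun j => (j == a %[mod Q]) && (j == c %[mod b]))%N P = (P %/ (Q * b))%N.
Proof.
move=> Q0 b0 cQb QbP; rewrite -(cnt_residue (chinese Q b a c) _ QbP) ?muln_gt0 ?Q0//.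
apply: eq_cnt => j; rewrite chinese_remainder//; congr (_ && _).
  by rewrite chinese_modl.
by rewrite chinese_modr.
Qed.

Section PatternsCoprime.
Variables (R : realType) (B : set nat).
Hypothesis B_gt1 : forall b, B b -> (1 < b)%N.
Hypothesis B_cop : forall a b, B a -> B b -> a != b -> coprime a b.
Hypothesis B_rich : rich B.
Hypothesis B_tail : forall (e : R) M0, 0 < e ->
  exists2 M, (M0 <= M)%N & summable_tail B M e.

(** Congruences make j avoid the small b at the ones of z and put a multiple of an auxiliary element
    of B at each zero. The other elements of B have so small a reciprocal sum that half of the
    solutions survive, and [freeB_of_freeK] applies to these. *)
Lemma admissible_pattern_occurs W (z : pred nat) :
  (forall b, B b -> exists r, forall i, (i < W)%N -> z i -> ~~ (b %| r + i)%N) ->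
  exists j, forall i, (i < W)%N -> freeB B (j + i)%N = z i.
Proof.
move=> adm.
have /choice[rho rhoP] : forall b, exists r, B b ->
    forall i, (i < W)%N -> z i -> ~~ (b %| r + i)%N.
  by move=> b; have [/adm[r h]|nB] := pselect (B b); [exists r|exists 0%N].
(* W <= M makes the auxiliary moduli longer than the window; the tail bound leaves room for W shifts
   at a loss below 1/2. *)
have [M WM tail] : exists2 M, (W <= M)%N & summable_tail B M ((2 * W.+1%:R)^-1 : R).
  by apply: B_tail; rewrite invr_gt0 mulr_gt0.
have [f [fB fM fc]] := rich_family W B_gt1 B_rich (fact_gt0 M).
have fgtM i : (i < W)%N -> (M < f i)%N.
  move=> iW; rewrite ltnNge; apply/negP => fiM.
  have f1 := B_gt1 (fB _ iW).
  have fd : (f i %| M`!)%N by rewrite dvdn_fact// fiM ltnW.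
  by move: (fM _ iW); rewrite /coprime; move/gcdn_idPl: fd => -> /eqP e; rewrite e in f1.
(* [inl b] prescribes j = rho b modulo b, as - (b - 1) rho b = rho b there; [inr i] prescribes that
   f i divides j + i. *)
pose q (t : nat + nat) : nat := match t with inl b => b | inr i => f i end.
pose r (t : nat + nat) : nat := match t with inl b => (b.-1 * rho b)%N | inr i => i end.
pose s : seq (nat + nat) := map inl (Bseq B M) ++
  map inr [seq i <- iota 0 W | ~~ z i].
have sP t : t \in s -> match t with
    inl b => b \in Bseq B M | inr i => (i < W)%N && ~~ z i end.
  rewrite mem_cat => /orP[/mapP[b h ->//]|/mapP[i + ->]].
  by rewrite mem_filter mem_iota add0n/= andbC.
have sl b : b \in Bseq B M -> inl b \in s.
  by move=> h; rewrite mem_cat map_f.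
have sr i : (i < W)%N -> ~~ z i -> inr i \in s.
  by move=> iW zi; rewrite mem_cat; apply/orP; right; rewrite map_f// mem_filter zi mem_iota.
have qB t : t \in s -> B (q t).
  by move/sP; case: t => [b /(Bseq_B B_gt1)//|i /andP[iW _]]; exact: fB.
have q0 t : t \in s -> (0 < q t)%N by move/qB/B_gt1/ltnW.
have [||a aP] := @chinese_seq _ s q r _ q0.
- rewrite cat_uniq !map_inj_uniq ?Bseq_uniq ?filter_uniq ?iota_uniq//; last 2 first.
  + by move=> ? ? [].
  + by move=> ? ? [].
  by rewrite andbT; apply/hasPn => t /mapP[i _ ->]; apply/mapP => -[].
- have lr b i : b \in Bseq B M -> (i < W)%N -> coprime b (f i).
    move=> bM iW; apply: coprime_dvdl (Bseq_dvd_fact B_gt1 bM) _.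
    by rewrite coprime_sym fM.
  move=> [b|i] [c|j] /sP ts /sP us ne /=.
  + by apply: B_cop; [exact: Bseq_B ts|exact: Bseq_B us|].
  + by apply: lr => //; case/andP: us.
  + by rewrite coprime_sym; apply: lr => //; case/andP: ts.
  + by case/andP: ts => ? _; case/andP: us => ? _; apply: fc.
set Q := (\prod_(t <- s) q t)%N.
have Q0 : (0 < Q)%N by rewrite /Q big_seq prodn_cond_gt0.
have qQ t : t \in s -> (q t %| Q)%N by exact: dvdn_prod_seq.
have B_dich b : B b -> (exists2 t, t \in s & q t = b) \/ coprime b Q.
  move=> Bb; have [h|h] := pselect (exists2 t, t \in s & q t = b); first by left.
  right; apply: coprime_prodr => t ts; apply: B_cop => //; first exact: qB.
  by apply/eqP => e; apply: h; exists t.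
have QR : 0 < Q%:R :> R by rewrite ltr0n.
have g0 : 0 < (2 * Q%:R)^-1 :> R by rewrite invr_gt0 mulr_gt0.
have [K hK] := freeB_of_freeK B_gt1 W g0.
pose rest := [seq b <- Bseq B K | coprime b Q].
have restP b : b \in rest -> [/\ B b, coprime b Q & (b %| K`!)%N].
  rewrite mem_filter => /andP[cb bK].
  by split=> //; [exact: Bseq_B bK|exact: Bseq_dvd_fact bK].
pose G j := (j == a %[mod Q])%N &&
  all (fun b => all (fun i => z i ==> ~~ (b %| j + i)%N) (iota 0 W)) rest.
pose P := (Q * K`!)%N.
have P0 : (0 < P)%N by rewrite muln_gt0 Q0 fact_gt0.
have pG : periodic P G.
  move=> j; rewrite /G; congr (_ && _); first by rewrite /P addnC mulnC modnMDl.
  apply: eq_in_all => b /restP[_ _ bK]; apply: eq_in_all => i _.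
  by rewrite -addnA [(P + i)%N]addnC addnA dvdn_addl// /P dvdn_mull.
have [|j i|j [/andP[ja _] jP]] := hK K (leqnn K) P G z P0 pG.
- have cE b i : b \in rest ->
    cnt (fun j => (j == a %[mod Q]) && (b %| j + i))%N P = (P %/ (Q * b))%N.
    move=> /restP[Bb cb bK]; have b1 := B_gt1 Bb; have b0 := ltnW b1.
    rewrite -(@cnt_two_residues Q b a (b.-1 * i)) ?dvdn_mul//; last first.
      by rewrite coprime_sym.
    apply: eq_cnt => j; congr (_ && _).
    have e : (b.-1 * i + i = b * i)%N by rewrite -[in RHS](prednK b0) mulSn addnC.
    by rewrite -(eqn_modDr i) e modnMr.
  (* Elements of B up to M divide Q, so [rest] lies beyond M and the tail bound controls it. *)
  have nQ b : b \in Bseq B M -> ~~ coprime b Q.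
    move=> bM; have := qQ _ (sl _ bM); have := B_gt1 (Bseq_B B_gt1 bM).
    by rewrite /coprime => b1 /gcdn_idPl /= ->; rewrite gtn_eqF.
  have tailK : \sum_(b <- rest) b%:R^-1 <= (2 * W.+1%:R)^-1 :> R.
    have [KM|/ltnW MK] := leqP K M.
      rewrite big_seq big1 ?invr_ge0 ?mulr_ge0// => b.
      rewrite mem_filter mem_Bseq// => /andP[cb /andP[Bb bK]].
      have bM : b \in Bseq B M by rewrite mem_Bseq// Bb (leq_trans bK).
      by case/negP: (nQ _ bM).
    apply: le_trans (tail K); rewrite /rest big_filter (Bseq_cat _ MK) big_cat/=.
    rewrite [X in X + _]big_seq_cond big1 ?add0r => [|b /andP[bM cb]].
      by rewrite big_mkcond/=; apply: ler_sum => b _; case: ifP; rewrite ?invr_ge0.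
    by case/negP: (nQ _ bM).
  (* Union bound inside the class of a modulo Q: each pair of b in [rest] and i < W excludes one
     class modulo b. *)
  have : (P %/ Q <= cnt G P + \sum_(b <- rest) \sum_(i <- iota 0 W) P %/ (Q * b))%N.
    rewrite -(cnt_residue a Q0 (dvdn_mulr _ (dvdnn Q))).
    rewrite (eq_big_seq (fun b => \sum_(i <- iota 0 W)
       cnt (fun j => (j == a %[mod Q]) && (b %| j + i)) P)%N); last first.
      by move=> b br; apply: eq_bigr => i _; rewrite cE.
    rewrite /cnt.
    under [X in (_ + X)%N]eq_bigr do rewrite exchange_big/=.
    rewrite exchange_big/= -big_split/=; apply: leq_sum => j _.
    rewrite /G; case: (j == a %[mod Q])%N => //=.
    case: (boolP (all _ rest)) => // /allPn[b br /allPn[i iW]].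
    rewrite negb_imply negbK => /andP[_ bji].
    rewrite add0n (perm_big _ (perm_to_rem br)) big_cons.
    by rewrite (perm_big _ (perm_to_rem iW)) big_cons bji.
  rewrite -(ler_nat R) natrD natr_sum natf_div ?dvdn_mulr// => h.
  have PR : 0 < P%:R :> R by rewrite ltr0n.
  rewrite /dens ler_pdivlMr//.
  have E : \sum_(b <- rest) (\sum_(i <- iota 0 W) P %/ (Q * b))%:R =
      P%:R / Q%:R * W%:R * \sum_(b <- rest) b%:R^-1 :> R.
    rewrite mulr_sumr; apply: eq_big_seq => b /restP[Bb cb bK].
    rewrite big_const_seq count_predT size_iota iter_addn_0 natrM natf_div ?dvdn_mul//.
    rewrite natrM invfM; ring.
  rewrite E in h.
  have : P%:R / Q%:R * W%:R * \sum_(b <- rest) b%:R^-1 <= P%:R / Q%:R / 2 :> R.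
    rewrite -!mulrA ler_wpM2l// ler_wpM2l ?invr_ge0//.
    apply: (@le_trans _ _ (W%:R * (2 * W.+1%:R)^-1)); first by rewrite ler_wpM2l.
    rewrite invfM mulrCA ler_piMr ?invr_ge0// ler_pdivrMr ?ltr0n// mul1r ler_nat.
    exact: leqnSn.
  rewrite invfM; move: h; set X := P%:R / Q%:R; set Y := X * _ * _ => h1 h2.
  have -> : 2^-1 / Q%:R * P%:R = X / 2 by rewrite /X; ring.
  lra.
- move=> /andP[ja /allP Gj] zi iW; apply/free_ofP => b bK.
  have Bb := Bseq_B B_gt1 bK; have b1 := B_gt1 Bb.
  have [[t ts tb]|cb] := B_dich _ Bb; last first.
    have /allP : all (fun i => z i ==> ~~ (b %| j + i)%N) (iota 0 W).
      by apply: Gj; rewrite mem_filter cb.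
    by move=> /(_ i); rewrite mem_iota iW zi; apply.
  have ba : (j = a %[mod b])%N.
    have bQ : (b %| Q)%N by rewrite -tb qQ.
    by rewrite -(modn_dvdm j bQ) (eqP ja) modn_dvdm.
  have -> : (b %| j + i)%N = (b %| a + i)%N by rewrite /dvdn -modnDml ba modnDml.
  have := aP _ ts; rewrite tb; case: t ts tb => [b'|i'] /sP /= ts tb.
    rewrite -tb in b1 Bb *.
    move=> bar; apply: contra (rhoP _ Bb _ iW zi) => bai.
    rewrite -(dvdn_addl _ bar).
    have -> : (rho b' + i + (a + b'.-1 * rho b') = a + i + b' * rho b')%N.
      by move: b1; case: (b') => // m _ /=; rewrite mulSn; lia.
    by rewrite dvdn_addl// dvdn_mulr.
  (* This b exceeds W, so it divides only one number of the window, the one at the zero i' of z. *)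
  move/andP: ts => [i'W zi'] bai'; apply/negP => bai.
  have bM : (M < b)%N by rewrite -tb fgtM.
  have ii' : i' != i by apply: contraNneq zi' => ->.
  have : (a + i == a + i' %[mod b])%N by rewrite (eqP bai) (eqP bai').
  rewrite eqn_modDl !modn_small; last 2 first.
  + exact: leq_trans i'W (leq_trans WM (ltnW bM)).
  + exact: leq_trans iW (leq_trans WM (ltnW bM)).
  by rewrite eq_sym (negbTE ii').
exists j => i iW; apply/idP/idP => [|zi]; last exact: jP.
apply: contraTT => zi; apply/freeBP => h.
have is_ := sr _ iW zi; have := h _ (qB _ is_); move/negP; apply.
rewrite /= /dvdn -modnDml -(modn_dvdm j (qQ _ is_)) (eqP ja) modn_dvdm ?qQ//.
by rewrite modnDml; exact: aP _ is_.
Qed.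

End PatternsCoprime.

(** * Independent positions when theta is positive *)

Section PositionSets.
Variable R : realType.

(** Translates j are sorted by their set [S j] of positions in A, whose mean size is at least t n.
    Sets smaller than t n / 2 contribute at most t n / 2 to the mean; if every larger one were rarer
    than t / 2^(n+2), all 2^n sets would add at most t n / 4. *)
Lemma popular_position_set (A : pred nat) (L n : nat) (t : R) :
  (0 < L)%N -> periodic L A -> t <= dens R A L -> 0 < t -> (0 < n)%N ->
  exists I : {set 'I_n}, t / 2 * n%:R <= #|I|%:R /\
    t / 2 ^+ n.+2 <= dens R (fun j => [forall i in I, A (j + i)%N]) L.
Proof.
move=> L0 pA tA t0 n0; apply: contrapT => /forallNP noI.
pose S j : {set 'I_n} := finset (fun i : 'I_n => A (j + i)%N).
pose c (I : {set 'I_n}) := (\sum_(0 <= j < L) (S j == I))%N.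
have cI I : (c I <= cnt (fun j => [forall i in I, A (j + i)%N]) L)%N.
  rewrite /c /cnt; apply: leq_sum => j _; case: eqP => // <-.
  have -> : [forall i in S j, A (j + i)%N] by apply/forall_inP => i; rewrite inE.
  by [].
have nR : 0 < n%:R :> R by rewrite ltr0n.
have LR : 0 < L%:R :> R by rewrite ltr0n.
have p2 : 0 < 2 ^+ n.+2 :> R by rewrite exprn_gt0.
have sumS : (n * cnt A L = \sum_(0 <= j < L) #|S j|)%N.
  under eq_bigr => j _ do rewrite -sum1_card big_mkcond/=.
  rewrite exchange_big/= (eq_bigr (fun=> cnt A L)) ?sum_nat_const ?card_ord//.
  move=> i _; rewrite -(cnt_window i pA); apply: eq_bigr => j _.
  by rewrite inE addnC; case: (A _).
have sumI : (\sum_(0 <= j < L) #|S j| = \sum_(I : {set 'I_n}) #|I| * c I)%N.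
  under [RHS]eq_bigr do rewrite big_distrr/=.
  rewrite exchange_big/=; apply: eq_bigr => j _.
  rewrite (bigD1 (S j))//= eqxx muln1 big1 ?addn0// => I.
  by rewrite eq_sym => /negbTE ->; rewrite muln0.
have sumc : (\sum_(I : {set 'I_n}) c I = L)%N.
  rewrite exchange_big/= (eq_bigr (fun=> 1%N)) ?sum_nat_const_nat ?subn0 ?muln1//.
  move=> j _; rewrite (bigD1 (S j))//= eqxx big1 ?addn0// => I.
  by rewrite eq_sym => /negbTE ->.
have bound (I : {set 'I_n}) : (#|I| * c I)%:R <=
    t / 2 * n%:R * (c I)%:R + n%:R * (t / 2 ^+ n.+2 * L%:R) :> R.
  have [small|big] := ltP (#|I|%:R : R) (t / 2 * n%:R).
    rewrite natrM; apply: ler_wpDr; last by rewrite ler_wpM2r// ltW.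
    by rewrite mulr_ge0// mulr_ge0// divr_ge0// ltW.
  have cL : (c I)%:R <= t / 2 ^+ n.+2 * L%:R :> R.
    rewrite -ler_pdivrMr// leNgt; apply/negP => h; apply: (noI I); split.
    - exact: big.
    - apply: (le_trans (ltW h)); rewrite /dens ler_wpM2r ?invr_ge0// ler_nat.
      exact: cI.
  rewrite natrM; apply: ler_wpDl; first by rewrite mulr_ge0// mulr_ge0// divr_ge0// ltW.
  apply: (@le_trans _ _ (n%:R * (c I)%:R)); last by rewrite ler_wpM2l.
  by rewrite ler_wpM2r// ler_nat (leq_trans (max_card _)) ?card_ord.
have : (n * cnt A L)%:R <= t / 2 * n%:R * L%:R + n%:R * (t / 4 * L%:R) :> R.
  rewrite sumS sumI natr_sum; apply: (le_trans (ler_sum _ (fun I _ => bound I))).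
  rewrite big_split/= -mulr_sumr -natr_sum sumc lerD2l sumr_const.
  have -> : #|{: {set 'I_n}}| = (2 ^ n)%N.
    by rewrite -cardsT -powersetT card_powerset cardsT card_ord.
  rewrite -[leLHS]mulr_natl natrX !exprS.
  have p2' : 2 ^+ n != 0 :> R by rewrite expf_neq0// pnatr_eq0.
  suff -> : 2 ^+ n * (n%:R * (t / (2 * (2 * 2 ^+ n)) * L%:R)) = n%:R * (t / 4 * L%:R) :> R.
    by [].
  by field.
rewrite natrM; have : t * L%:R <= (cnt A L)%:R by rewrite -ler_pdivlMr.
move=> h1; have : n%:R * (t * L%:R) <= n%:R * (cnt A L)%:R by rewrite ler_wpM2l// ltW.
have : 0 < n%:R * (t * L%:R) by rewrite !mulr_gt0.
lra.
Qed.

End PositionSets.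

Section Independence.
Variables (R : realType) (B : set nat).
Hypothesis B_gt1 : forall b, B b -> (1 < b)%N.
Hypothesis B_rich : rich B.
Hypothesis theta_gt0 : 0 < theta R B.

(* A translate j with j + I free of B /\ [1, K] is moved, along the primes of
   the auxiliary moduli only, so that f i divides j + i for i in J; as the
   f i have no prime factor below n, the other j + i then become coprime to
   all f i and so stay free. *)
Lemma independent_positions n : (0 < n)%N -> exists I : {set 'I_n},
  theta R B / 2 * n%:R <= #|I|%:R /\
  forall z : pred nat, exists j, forall i : 'I_n, i \in I -> freeB B (j + i)%N = z i.
Proof.
move=> n0.
have [f [fB fn fc]] := rich_family n B_gt1 B_rich (fact_gt0 n).
have f0 i : (i < n)%N -> (0 < f i)%N by move/fB/B_gt1/ltnW.
pose Q := (\prod_(i < n) f i)%N.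
have Q0 : (0 < Q)%N by rewrite prodn_gt0// => i; exact: f0.
have QR : 0 < Q%:R :> R by rewrite ltr0n.
(* Q bounds the modulus QJ of every pattern z, so [g], [K] and [I] are fixed before z is given. *)
pose g := theta R B / 2 ^+ n.+2 / Q%:R.
have g0 : 0 < g by rewrite !divr_gt0// exprn_gt0.
have [K hK] := freeB_of_freeK B_gt1 n g0.
have [I [Isize Idens]] := popular_position_set (fact_gt0 K)
  (@freeK_periodic B B_gt1 K) (theta_le R B K) theta_gt0 n0.
exists I; split=> // z; pose E j := [forall i in I, freeK B K (j + i)%N].
have {}Idens : theta R B / 2 ^+ n.+2 <= dens R E K`! by [].
pose s : seq 'I_n := [seq i : 'I_n <- enum I | ~~ z i].
pose QJ := (\prod_(i <- s) f i)%N.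
have QJ0 : (0 < QJ)%N by rewrite prodn_gt0// => i; exact: f0.
have QJQ : (QJ <= Q)%N.
  rewrite /QJ /s big_filter big_enum_cond/= /Q.
  rewrite [leqRHS](bigID (fun i : 'I_n => (i \in I) && ~~ z i))/=.
  by rewrite leq_pmulr// prodn_gt0// => i; exact: f0.
have [|i _|i j _ _ ij|c cP] := @chinese_seq _ s (fun i : 'I_n => f i) (@nat_of_ord n).
- by rewrite filter_uniq// enum_uniq.
- exact: f0.
- exact: fc.
set pi := (\pi(QJ)^')%N.
(* The part of K! prime to QJ: residues modulo M are kept, those at the primes of QJ are given
   up. *)
pose M := (K`!`_pi)%N.
have M0 : (0 < M)%N by exact: part_gt0.
have MK : (M %| K`!)%N by exact: dvdn_part.
have cMQ : coprime M QJ.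
  by rewrite coprime_sym coprime_pi'// part_pnat.
pose E' j := [exists j0 : 'I_K`!, E j0 && (j == j0 %[mod M])%N].
have pE' : periodic M E'.
  by move=> j; apply: eq_existsb => j0; rewrite modnDr.
have pE : periodic K`! E.
  move=> j; apply: eq_forallb => i; congr (_ ==> _).
  by rewrite addnAC (freeK_periodic B_gt1).
pose G j := E' j && (j == c %[mod QJ])%N.
have P0 : (0 < M * QJ)%N by rewrite muln_gt0 M0.
have pG : periodic (M * QJ) G.
  move=> j; rewrite /G (periodic_dvd (dvdn_mulr _ (dvdnn M)) pE').
  by rewrite addnC modnMDl.
(* E' contains E and is independent of the class modulo QJ, so G has density at least that of E
   divided by QJ. *)
have gG : g <= dens R G (M * QJ).
  have -> : dens R G (M * QJ) = dens R E' M / QJ%:R.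
    by rewrite /dens cnt_coprime_class// natrM invfM mulrA.
  rewrite (dens_dvd _ (fact_gt0 K) MK pE').
  apply: (@le_trans _ _ (dens R E K`! / QJ%:R)).
    rewrite /g; apply: ler_pM => //.
    - by rewrite divr_ge0 ?exprn_ge0// ltW.
    - by rewrite lef_pV2 ?posrE ?ltr0n// ler_nat.
  rewrite ler_wpM2r ?invr_ge0//; apply: ler_dens => j Ej.
  apply/existsP; exists (Ordinal (ltn_pmod j (fact_gt0 K))) => /=.
  by rewrite (periodic_mod _ pE) Ej/= modn_dvdm.
have [|j [/andP[_ jc] jF]] := hK K (leqnn K) _ G
    (fun i => if insub i is Some i' then (i' \in I) && z i else false) P0 pG gG.
  move=> j i /andP[/existsP[j0 /andP[/forall_inP Ej0 jj0]] jc].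
  case: insubP => // i' _ ii' /andP[i'I zi] iN; rewrite -ii' in zi iN *.
  apply/free_ofP => b bK; apply/negP => bji.
  (* A common divisor of b and f i0 divides j + i' and j + i0, hence their difference and n!, to
     which f i0 is coprime. *)
  have cb : coprime b QJ.
    apply: coprime_prodr => i0; rewrite mem_filter mem_enum => /andP[zi0 i0I].
    have i0i : (i0 : nat) != i' by apply: contraNneq zi0 => ->.
    have fj : (f i0 %| j + i0)%N.
      have i0s : i0 \in s by rewrite mem_filter zi0 mem_enum.
      have fQ : (f i0 %| QJ)%N.
        exact: (@dvdn_prod_seq _ s (fun i : 'I_n => f i) _ i0s).
      rewrite /dvdn -modnDml -(modn_dvdm j fQ) (eqP jc) modn_dvdm// modnDml; exact: cP.
    rewrite /coprime; set d := gcdn _ _.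
    have db : (d %| j + i')%N by apply: dvdn_trans bji; exact: dvdn_gcdl.
    have df : (d %| f i0)%N by exact: dvdn_gcdr.
    have df' : (d %| j + i0)%N by exact: dvdn_trans fj.
    have dn : (d %| n`!)%N.
      have [lt|ge] := ltnP i0 i'.
        apply: (@dvdn_trans (i' - i0)).
          by rewrite -(subnDl j) dvdn_sub.
        by apply: dvdn_fact; rewrite subn_gt0 lt/=; apply: leq_trans (leq_subr _ _) (ltnW _).
      have lt : (i' < i0)%N by rewrite ltn_neqAle eq_sym i0i.
      apply: (@dvdn_trans (i0 - i')).
        by rewrite -(subnDl j) dvdn_sub.
      by apply: dvdn_fact; rewrite subn_gt0 lt/=; apply: leq_trans (leq_subr _ _) (ltnW _).
    have : (d %| gcdn (f i0) n`!)%N by rewrite dvdn_gcd df.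
    by rewrite (eqP (fn _ (ltn_ord i0))) dvdn1.
  (* Hence j and j0 agree modulo b, and b would divide j0 + i', which is free. *)
  have bM : (b %| M)%N.
    have b0 : (0 < b)%N by apply: Bseq_gt0 bK.
    rewrite -(@part_pnat_id pi b) ?partn_dvd ?fact_gt0 ?(Bseq_dvd_fact B_gt1)//.
    by rewrite -coprime_pi'// coprime_sym.
  have := Ej0 _ i'I; move/free_ofP/(_ _ bK)/negP; apply.
  by rewrite /dvdn -modnDml -(modn_dvdm j0 bM) -(eqP jj0) modn_dvdm// modnDml.
exists j => i iI; case: (boolP (z i)) => zi.
  by apply: jF (ltn_ord i); rewrite valK iI.
apply/negP => /freeBP/(_ _ (fB _ (ltn_ord i)))/negP; apply.
have is_ : i \in s by rewrite mem_filter zi mem_enum.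
have fQ : (f i %| QJ)%N by exact: (@dvdn_prod_seq _ s (fun i : 'I_n => f i) _ is_).
rewrite /dvdn -modnDml -(modn_dvdm j fQ) (eqP jc) modn_dvdm// modnDml; exact: cP.
Qed.

End Independence.

(** * Pairwise coprimality from admissible patterns *)

Section PrimitiveCoprime.
Local Open Scope nat_scope.

(** An elementary substitute for Dirichlet's theorem. With a = g a1 and b = g b1, the number a1 + b1
    t is coprime to M when t is the part of M prime to a1: a prime of M divides exactly one of a1
    and b1 t. *)
Lemma residue_rep_gcd a b M : 0 < b -> 0 < M ->
  exists2 n, n = a %[mod b] & gcdn n M %| gcdn a b.
Proof.
move=> b0 M0; wlog a0 : a / 0 < a.
  move=> W; have [|n nab] := W (a + b); first by rewrite addn_gt0 b0 orbT.
  by rewrite [gcdn (a + b) b]gcdnC gcdnDr [gcdn b a]gcdnC => h; exists n => //; rewrite nab modnDr.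
have g0 : 0 < gcdn a b by rewrite gcdn_gt0 a0.
set g := gcdn a b in g0 *.
have /dvdnP[a1 ag] : g %| a by exact: dvdn_gcdl.
have /dvdnP[b1 bg] : g %| b by exact: dvdn_gcdr.
have cab : coprime a1 b1.
  by rewrite /coprime -(eqn_pmul2r g0) muln_gcdl -ag -bg mul1n.
have a10 : 0 < a1 by move: a0; rewrite ag muln_gt0 => /andP[].
pose t := M`_(\pi(a1)^'); pose m := a1 + b1 * t.
have cat : coprime a1 t by rewrite coprime_pi' ?part_pnat// part_gt0.
have cma : coprime a1 m by rewrite /m /coprime addnC gcdnDr -/(coprime _ _) coprimeMr cab.
have m0 : 0 < m by rewrite addn_gt0 a10.
have cmM : coprime m M.
  rewrite -(@partnC \pi(a1) M)// coprimeMr; apply/andP; split.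
    by rewrite coprime_sym; apply: (@pnat_coprime \pi(a1)); rewrite ?part_pnat// -coprime_pi'.
  by rewrite -/t coprime_sym /m /coprime addnC gcdnMDl -/(coprime _ _) coprime_sym.
exists (g * m); last first.
  rewrite gcdnC Gauss_gcdl; last by rewrite coprime_sym.
  exact: dvdn_gcdr.
by rewrite /m mulnDr [g * a1]mulnC -ag mulnA [g * b1]mulnC -bg addnC mulnC modnMDl.
Qed.

Lemma dvdn_of_pfactor q e b c : prime q -> 0 < b -> logn q b = e ->
  c %| b * q -> ~~ (q ^ e.+1 %| c) -> c %| b.
Proof.
move=> pq b0 be cbq nc; have bq0 : 0 < b * q by rewrite muln_gt0 b0 prime_gt0.
have c0 : 0 < c by exact: dvdn_gt0 cbq.
have [c' qc' ce] := pfactor_coprime pq c0.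
rewrite ce in cbq nc *; move: nc.
set k := logn q c; have [ek|ke _] := ltnP e k.
  by rewrite dvdn_mull// dvdn_exp2l.
rewrite Gauss_dvd; last by rewrite coprime_sym coprimeXl.
rewrite pfactor_dvdn// be ke andbT.
rewrite -(@Gauss_dvdl c' b q); last by rewrite coprime_sym.
by apply: dvdn_trans cbq; exact: dvdn_mulr.
Qed.

Lemma missed_residue (s : seq nat) c : size s < c ->
  exists r, forall n, n \in s -> n != r %[mod c].
Proof.
move=> sc; have c0 : 0 < c by apply: leq_ltn_trans sc.
have [/hasP[r]|/hasPn h] := boolP (has (fun r => r \notin [seq n %% c | n <- s]) (iota 0 c)).
  rewrite mem_iota add0n => /andP[_ rc] rs; exists r => n ns.
  by apply: contra rs => /eqP; rewrite (modn_small rc) => <-; exact: map_f.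
have : size (iota 0 c) <= size [seq n %% c | n <- s].
  by apply: uniq_leq_size; [exact: iota_uniq|move=> r /h; rewrite negbK].
by rewrite size_iota size_map leqNgt sc.
Qed.

Lemma exists_neg_residue j b : 0 < b -> exists2 a, a < b & b %| a + j.
Proof.
move=> b0; exists ((b - j %% b) %% b); first exact: ltn_pmod.
rewrite /dvdn modnDml -modnDmr subnK ?modnn// ltnW// ltn_pmod//.
Qed.

Variable B : set nat.
Hypothesis B_gt1 : forall b, B b -> 1 < b.
Hypothesis B_prim : forall a b, B a -> B b -> a %| b -> a = b.
Hypothesis B_pat : forall (A : seq nat) N,
  (forall c, B c -> exists r, forall n, n \in A -> n != r %[mod c]) ->
  exists j, forall n, n \in A -> freeK B N (n + j).

(** If d > 1, a finite set A is built from [n1], meeting all nonzero classes modulo b', and [n2],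
    meeting all classes modulo b divisible by d. It is admissible, yet each of its translates
    contains a multiple of b or b'. *)
Lemma coprime_of_admissible_patterns b b' : B b -> B b' -> b != b' -> coprime b b'.
Proof.
move=> Bb Bb' bb'; rewrite /coprime; set d := gcdn b b'.
have b0 : 0 < b by apply: ltnW; exact: B_gt1.
have b'0 : 0 < b' by apply: ltnW; exact: B_gt1.
have d0 : 0 < d by rewrite gcdn_gt0 b0.
have db : d %| b by exact: dvdn_gcdl.
have db' : d %| b' by exact: dvdn_gcdr.
case: (ltngtP d 1) => // [|d1]; first by rewrite ltnS leqNgt d0.
(* By primitivity b does not divide b', so some prime has a larger exponent in b. *)
have [q [pq qlt]] : exists q, prime q /\ logn q b' < logn q b.
  apply: contrapT => /forallNP h; move/eqP: bb'; apply; apply: B_prim => //.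
  apply/(dvdn_partP _ b0) => p pb; rewrite p_part pfactor_dvdn//; last first.
    by move: pb; rewrite mem_primes => /andP[].
  rewrite leqNgt; apply/negP => lt; apply: (h p); split => //.
  by move: pb; rewrite mem_primes => /andP[].
set e := logn q b' in qlt; pose E := q ^ e.+1.
have Eb : E %| b by rewrite pfactor_dvdn.
have qeb' : q ^ e %| b' by rewrite pfactor_dvdn.
have nEb' : ~~ (E %| b') by rewrite pfactor_dvdn// ltnn.
(* u is the class modulo b that A will miss: [n2] avoids it because d does not divide u, and the
   alternative lets [n1] avoid it modulo E. *)
have [u [ndu uE]] : exists u, ~~ (d %| u) /\ (E %| u \/ ~~ (q ^ e %| u)).
  have [dE|dE] := boolP (d %| E); last by exists E; split => //; left.
  exists 1; split; first by rewrite dvdn1 gtn_eqF.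
  right; rewrite dvdn1 -(expn0 q) eqn_exp2l ?prime_gt1// -lt0n logn_gt0 mem_primes pq b'0/=.
  apply: dvdn_trans db'; move: dE => /(dvdn_pfactor _ _ pq)[[|m] _ de].
    by move: d1; rewrite de.
  by rewrite de expnS dvdn_mulr.
pose N := b + b'; have M0 := fact_gt0 N.
have cM c : B c -> c <= N -> c %| N`!.
  by move=> /B_gt1/ltnW c0 cN; apply: dvdn_fact; rewrite c0.
have /choice[n1 n1P] : forall a, exists n, 0 < a < b' ->
    [/\ n = a %[mod b'], n != u %[mod b] & forall c, B c -> c <= N -> ~~ (c %| n)].
  move=> a; have [/andP[a0 ab]|//] := boolP (0 < a < b'); last by exists 0.
  (* a' is a or a + b': adding b' changes the residue modulo E, and in each case of [uE] one of the
     two choices satisfies both conditions. *)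
  have [a' [a'a nEa' a'u]] : exists a', [/\ a' = a %[mod b'], ~~ (E %| a') & a' != u %[mod E]].
    have dist : a != a + b' %[mod E].
      rewrite -{1}[a]addn0 eqn_modDl mod0n eq_sym; exact: nEb'.
    have qeE : q ^ e %| E by exact: dvdn_exp2l.
    case: uE => [Eu|nqu].
      have h x : ~~ (E %| x) -> x != u %[mod E] by rewrite (eqP Eu).
      have [Ea|nEa] := boolP (E %| a); last by exists a; split => //; exact: h.
      exists (a + b'); split; first by rewrite modnDr.
        by rewrite dvdn_addr.
      by apply: h; rewrite dvdn_addr.
    have [qa|nqa] := boolP (q ^ e %| a).
      have h x : q ^ e %| x -> x != u %[mod E].
        move=> qx; apply: contra nqu => /eqP xu.
        by rewrite /dvdn -(modn_dvdm u qeE) -xu modn_dvdm.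
      have [Ea|nEa] := boolP (E %| a); last by exists a; split => //; exact: h.
      exists (a + b'); split; first by rewrite modnDr.
        by rewrite dvdn_addr.
      by apply: h; rewrite dvdn_add.
    have h x : ~~ (q ^ e %| x) -> ~~ (E %| x) by apply: contra; exact: dvdn_trans.
    have [au|au] := boolP (a == u %[mod E]); last by exists a; split => //; exact: h.
    exists (a + b'); split; first by rewrite modnDr.
      by apply: h; rewrite dvdn_addl.
    by rewrite -(eqP au) eq_sym.
  have b'q0 : 0 < b' * q by rewrite muln_gt0 b'0 prime_gt0.
  have [n na' ngcd] := residue_rep_gcd a' b'q0 M0.
  have EbE : E %| b' * q by rewrite /E expnSr dvdn_mul.
  exists n => _; split.
  - by rewrite -a'a -(modn_dvdm n (dvdn_mulr q (dvdnn b'))) na' modn_dvdm// dvdn_mulr.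
  - apply: contra a'u => /eqP nu.
    by rewrite -(modn_dvdm a' EbE) -na' modn_dvdm// -(modn_dvdm n Eb) nu modn_dvdm.
  (* Such a c divides a' and b' q; as E does not divide a', c divides b', so c = b', which does not
     divide a. *)
  - move=> c Bc cN; apply/negP => cn.
    have := dvdn_trans _ ngcd => /(_ c); rewrite dvdn_gcd cn cM// => /(_ isT).
    rewrite dvdn_gcd => /andP[ca' cb'q].
    have cb' : c = b'.
      apply: B_prim => //; apply: (dvdn_of_pfactor pq b'0 erefl cb'q).
      by apply: contra nEa' => /dvdn_trans; apply.
    have : b' %| a by rewrite /dvdn -a'a -/(dvdn _ _) -cb'.
    by move=> /dvdn_leq => /(_ a0); rewrite leqNgt ab.
have /choice[n2 n2P] : forall a, exists n, d %| a ->
    [/\ n = a %[mod b], n != u %[mod b] & forall c, B c -> c <= N -> c != b -> ~~ (c %| n)].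
  move=> a; have [da|//] := boolP (d %| a); last by exists 0.
  have [n na ngcd] := residue_rep_gcd a b0 M0.
  exists n => _; split => //.
    apply: contra ndu => /eqP nu.
    by rewrite /dvdn -(modn_dvdm u db) -nu na modn_dvdm.
  move=> c Bc cN; apply: contra => cn; apply/eqP/B_prim => //.
  have := dvdn_trans _ ngcd => /(_ c); rewrite dvdn_gcd cn cM// => /(_ isT).
  by rewrite dvdn_gcd => /andP[].
pose A := [seq n1 a | a <- iota 1 b'.-1] ++ [seq n2 a | a <- iota 0 b & d %| a].
have A1 a : 0 < a < b' -> n1 a \in A.
  move=> h; rewrite mem_cat map_f// mem_iota add1n prednK//.
have A2 a : a < b -> d %| a -> n2 a \in A.
  by move=> ab da; rewrite mem_cat orbC map_f// mem_filter da mem_iota.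
have AP n : n \in A -> (exists2 a, 0 < a < b' & n = n1 a) \/ (exists2 a, d %| a & n = n2 a).
  rewrite mem_cat => /orP[] /mapP[a].
    by rewrite mem_iota add1n prednK// => h ->; left; exists a.
  by rewrite mem_filter => /andP[h _] ->; right; exists a.
have [|j jP] := @B_pat A N.
  (* Beyond N, A has too few elements to fill the classes; up to N the missed class is u for b and 0
     otherwise. *)
  move=> c Bc; have [cN|Nc] := leqP c N; last first.
    apply: missed_residue; apply: leq_trans Nc; rewrite size_cat !size_map size_iota ltnS.
    rewrite /N addnC leq_add ?leq_pred// size_filter.
    by apply: leq_trans (count_size _ _) _; rewrite size_iota.
  have [->|cb] := eqVneq c b.
    exists u => n /AP[[a ha ->]|[a ha ->]].
      by have [] := n1P a ha.
    by have [] := n2P a ha.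
  exists 0 => n /AP[[a ha ->]|[a ha ->]]; rewrite mod0n.
    by have [_ _] := n1P a ha; apply.
  by have [_ _] := n2P a ha; apply.
have jB c n : B c -> c <= N -> n \in A -> ~~ (c %| n + j).
  move=> Bc cN nA; have /free_ofP := jP n nA; apply.
  by rewrite mem_Bseq// cN andbT; exact/asboolP.
(* All nonzero classes modulo b' are met, so b' divides j; then -j modulo b is a multiple of d, a
   class that is met too. *)
have [a ab' aj] := exists_neg_residue j b'0.
have a0 : a = 0.
  apply/eqP; apply: contraTT aj; rewrite -lt0n => a0.
  have h : 0 < a < b' by rewrite a0.
  have [na _ _] := n1P a h; have := jB b' _ Bb' (leq_addl _ _) (A1 _ h).
  by rewrite /dvdn -modnDml na modnDml.
move: aj; rewrite a0 add0n => b'j.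
have [a2 a2b a2j] := exists_neg_residue j b0.
have da2 : d %| a2.
  rewrite -(dvdn_addl _ (dvdn_trans db' b'j)); exact: dvdn_trans a2j.
have [na _ _] := n2P a2 da2; have := jB b _ Bb (leq_addr _ _) (A2 _ a2b da2).
by rewrite /dvdn -modnDml na modnDml -/(dvdn _ _) a2j.
Qed.

End PrimitiveCoprime.

(** * Behrend and Erdos sets *)

Section Cesaro.
Variable R : realType.

Let telescope_inv (x y : R) : 0 < y -> x / y = x / (y + 1) + x / (y * (y + 1)).
Proof.
move=> y0; have y1 : y + 1 != 0 by rewrite gt_eqF// addr_gt0.
by field; rewrite y1 gt_eqF.
Qed.

(** Partial summation against the counting function f. *)
Lemma logsum_small_density (A : pred nat) (e : R) N0 N : 0 <= e ->
  (forall M, (N0 <= M)%N -> (\sum_(1 <= m < M.+1) A m)%N%:R <= e * M%:R) ->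
  logsum R A N <= (N0 + 1)%:R + e * harm R N.
Proof.
move=> e0 small; pose f M : R := (\sum_(1 <= m < M.+1) A m)%N%:R.
have fM M : f M <= M%:R.
  rewrite ler_nat -[leqRHS]muln1 -[X in (_ <= X * 1)%N](subn1 M.+1).
  by rewrite -sum_nat_const_nat; apply: leq_sum => i _; case: (A i).
(* The first term is the boundary term of the summation; [minn M N0] pays 1 for each initial step,
   where only f M <= M is available. *)
have step M : logsum R A M <= f M / M.+1%:R + (minn M N0)%:R + e * harm R M.
  elim: M => [|M IH].
    by rewrite /logsum big_geq// !addr_ge0// ?divr_ge0// mulr_ge0// logsum_ge0.
  have M1 : 0 < M.+1%:R :> R by [].
  have M2 : 0 < M.+2%:R :> R by [].
  have fS : f M.+1 = f M + (A M.+1)%:R by rewrite /f big_nat_recr//= natrD.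
  have -> : logsum R A M.+1 = logsum R A M + (A M.+1)%:R / M.+1%:R.
    by rewrite /logsum big_nat_recr.
  have fS' : f M / M.+1%:R + (A M.+1)%:R / M.+1%:R =
      f M.+1 / M.+2%:R + f M.+1 / (M.+1%:R * M.+2%:R).
    by rewrite -mulrDl -fS -[M.+2%:R]natr1 telescope_inv.
  rewrite harmS mulrDr.
  suff : f M.+1 / (M.+1%:R * M.+2%:R) <= (minn M.+1 N0)%:R - (minn M N0)%:R + e / M.+1%:R.
    move: IH fS'; set x := f M / _; set y := f M.+1 / M.+2%:R; set z := f M.+1 / (_ * _).
    by set w := (A _)%:R / _; set v := e / _; lra.
  have [MN|NM] := ltnP M N0.
    rewrite (minn_idPl MN); have -> : M.+1%:R - M%:R = 1 :> R.
      by rewrite -natr1 addrAC subrr add0r.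
    rewrite ler_wpDr ?divr_ge0//.
    rewrite ler_pdivrMr ?mulr_gt0// mul1r; apply: le_trans (fM _) _.
    by rewrite ler_peMr ?ler1n.
  rewrite (minn_idPr (leqW NM)) subrr add0r invfM mulrA.
  rewrite [_ / M.+1%:R]mulrC -mulrA ler_pdivrMl// mulrCA.
  rewrite divff ?mulr1 ?gt_eqF// ler_pdivrMr//; apply: le_trans (small _ _) _.
    exact: leqW.
  by rewrite ler_wpM2l// ler_nat.
apply: le_trans (step N) _; rewrite lerD2r addrC natrD lerD ?ler_nat ?geq_minr//.
rewrite ler_pdivrMr// mul1r; apply: le_trans (fM N) _; by rewrite ler_nat.
Qed.

End Cesaro.

Section BehrendTheta.
Variables (R : realType) (B : set nat).
Hypothesis B_gt1 : forall b, B b -> (1 < b)%N.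

Lemma bfree_nat n : `[< bfree B n%:Z >] = freeB B n.
Proof.
apply/asboolP/freeBP => [[_ h] b Bb|h]; last first.
  by split => // -[b Bb /=]; rewrite dvdzE/=; apply/negP; exact: h.
by apply/negP => bn; apply: h; exists b => //=; rewrite dvdzE.
Qed.

Lemma count_bfree N :
  count (fun n : nat => `[< bfree B n%:Z >]) (iota 1 N) = (\sum_(1 <= m < N.+1) freeB B m)%N.
Proof.
rewrite (eq_count bfree_nat) -sum1_count big_mkcond/= /index_iota subn1/=.
by apply: eq_bigr => i _; case: (freeB B i).
Qed.

(** For N >= K!, at most 2 N / K! periods cover [1, N], so the proportion of B-free numbers is at
    most 2 [dK K]. *)
Lemma behrend_of_dK : (forall e : R, 0 < e -> exists K, dK R B K < e) -> behrend R B.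
Proof.
move=> small; apply/cvgrPdist_le => /= e e0.
have [|K hK] := small (e / 2); first by rewrite divr_gt0.
have K0 : 0 < K`!%:R :> R by rewrite ltr0n fact_gt0.
near=> N.
have N0 : 0 < N%:R :> R by rewrite ltr0n; near: N; exists 1%N.
rewrite sub0r normrN ger0_norm ?divr_ge0// count_bfree ler_pdivrMr//.
apply: (@le_trans _ _ ((N %/ K`!).+1 * cnt (freeK B K) K`!)%:R).
  rewrite ler_nat; apply: leq_trans (cnt_le_window 1 N (fact_gt0 K) (@freeK_periodic B B_gt1 K)).
  rewrite big_add1; apply: leq_sum => i _; rewrite add1n.
  by have := @freeB_freeK B B_gt1 K i.+1; case: (freeB _ _) => // ->.
rewrite natrM.
have -> : (cnt (freeK B K) K`!)%:R = K`!%:R * dK R B K.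
  by rewrite /dK /dens mulrC divfK ?gt_eqF.
rewrite mulrA -natrM.
have h : ((N %/ K`!).+1 * K`!)%:R <= N%:R + N%:R :> R.
  rewrite -natrD ler_nat mulSn addnC leq_add ?leq_trunc_div//.
  by near: N; exists K`!.
apply: (@le_trans _ _ ((N%:R + N%:R) * dK R B K)).
  by rewrite ler_wpM2r ?dK_ge0.
have := dK_ge0 R B K; nra.
Unshelve. all: by end_near. Qed.

(** Natural density zero bounds [logsum] by (theta / 2) [harm] up to a constant, against the lower
    bound theta [harm]. *)
Lemma theta_eq0_of_behrend : behrend R B -> ~ 0 < theta R B.
Proof.
move=> /cvgrPdist_le beh t0; have [|N0 _ hN0] := beh (theta R B / 2).
  by rewrite divr_gt0.
have small M : (N0 <= M)%N -> (\sum_(1 <= m < M.+1) freeB B m)%N%:R <= theta R B / 2 * M%:R.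
  move=> NM; have [->|M0] := posnP M; first by rewrite big_geq// mulr0.
  have := hN0 M NM; rewrite /= sub0r normrN ger0_norm ?divr_ge0// count_bfree.
  by rewrite ler_pdivrMr// ltr0n.
have [N hN] := harm_unbounded ((N0 + 1)%:R * 2 / theta R B).
have t2 : 0 <= theta R B / 2 by rewrite divr_ge0// ltW.
have := le_trans (logsum_freeB_ge R B_gt1 N) (logsum_small_density N t2 small).
by move: hN; rewrite ltr_pdivrMr//; lra.
Qed.

(** If no b is coprime to m, every j = 1 modulo m is B-free, so each [dK K] is at least 1 / m. *)
Lemma rich_of_behrend : behrend R B -> rich B.
Proof.
move=> beh m m0; apply: contrapT => h.
have free1 K j : coprime j m -> freeK B K j.
  move=> jm; apply/free_ofP => b; rewrite mem_Bseq// => /andP[/asboolP Bb _].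
  by apply/negP => bj; apply: h; exists b => //; exact: coprime_dvdl bj jm.
apply: (theta_eq0_of_behrend beh); apply: (@lt_le_trans _ _ m%:R^-1).
  by rewrite invr_gt0 ltr0n.
apply: lb_le_inf; first by exists (dK R B 0), 0%N.
move=> _ [K _ <-].
have -> : dK R B K = dens R (freeK B K) (m * K`!).
  by rewrite dens_mul//; exact: freeK_periodic.
have mK0 : (0 < m * K`!)%N by rewrite muln_gt0 m0 fact_gt0.
rewrite /dens ler_pdivlMr ?ltr0n// natrM mulKf ?pnatr_eq0 -?lt0n// ler_nat.
rewrite -[leqLHS](mulKn K`! m0) -(cnt_residue 1 m0 (dvdn_mulr _ (dvdnn m))).
apply: leq_cnt => i /eqP im; apply: free1.
by rewrite -coprime_modl im coprime_modl coprime1n.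
Qed.


End BehrendTheta.

Section ErdosSums.
Variables (R : realType) (B : set nat).
Hypothesis B_gt1 : forall b, B b -> (1 < b)%N.

Let S K : R := \sum_(b <- Bseq B K) b%:R^-1.

Let esum_partial K : (\sum_(0 <= b < K.+1 | `[< B b >]) (b%:R^-1 : R)%:E)%E = (S K)%:E.
Proof.
rewrite sumEFin /S big_filter big_ltn_cond//=.
case: ifP => [/asboolP/B_gt1//|_].
by rewrite /index_iota subn1.
Qed.

Let esumE : (\esum_(b in B) (b%:R^-1 : R)%:E =
  \sum_(0 <= b <oo | `[< B b >]) (b%:R^-1 : R)%:E)%E.
Proof.
rewrite nneseries_esum => [|n _]; last by rewrite lee_fin.
congr esum; apply/seteqP; split => b /=; first exact: asboolT.
by move/asboolP.
Qed.

Lemma summable_tail_of_esum : (\esum_(b in B) (b%:R^-1 : R)%:E < +oo)%E ->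
  forall (e : R) M0, 0 < e -> exists2 M, (M0 <= M)%N & summable_tail B M e.
Proof.
rewrite esumE => sfin e M0 e0.
have Sle K : ((S K)%:E <= \sum_(0 <= b <oo | `[< B b >]) (b%:R^-1 : R)%:E)%E.
  by rewrite -esum_partial; apply: nneseries_lim_ge => n _ _; rewrite lee_fin.
have Sbnd : has_sup (range S).
  split; first by exists (S 0), 0%N.
  exists (fine (\sum_(0 <= b <oo | `[< B b >]) (b%:R^-1 : R)%:E)%E) => _ [K _ <-].
  rewrite -lee_fin fineK// ge0_fin_numE//.
  by apply: nneseries_ge0 => n _ _; rewrite lee_fin.
have Smono K K' : (K <= K')%N -> S K <= S K'.
  by move=> KK; rewrite /S (Bseq_cat _ KK) big_cat/= lerDl sumr_ge0// => i _; rewrite invr_ge0.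
have [_ [M1 _ <-] hM] := sup_adherent e0 Sbnd.
exists (maxn M0 M1) => [|K]; first exact: leq_maxl.
set M := maxn M0 M1; have [KM|/ltnW MK] := leqP K M.
  by move: KM; rewrite -subn_eq0 => /eqP ->; rewrite big_nil ltW.
have SK : S K = S M + \sum_(b <- [seq b <- iota M.+1 (K - M) | `[< B b >]]) b%:R^-1.
  by rewrite /S (Bseq_cat _ MK) big_cat.
have : S K <= sup (range S) by apply: ub_le_sup; [exact: Sbnd.2|exists K].
by have := Smono _ _ (leq_maxr M0 M1); rewrite -/M SK; lra.
Qed.

Lemma esum_of_theta : (forall a b, B a -> B b -> a != b -> coprime a b) ->
  0 < theta R B -> (\esum_(b in B) (b%:R^-1 : R)%:E < +oo)%E.
Proof.
move=> cop t0; rewrite esumE; apply: (@le_lt_trans _ _ ((theta R B)^-1)%:E); last exact: ltry.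
apply: lime_le; first by apply: is_cvg_nneseries_cond => n _ _; rewrite lee_fin.
exists 1%N => // -[|K] // _ /=; rewrite esum_partial lee_fin.
exact: sum_inv_le.
Qed.

(** If every b shared a factor with m, the gcds of m distinct b with m would be coprime, at least 2
    and have a product dividing m, so 2^m <= m. *)
Lemma rich_of_coprime : infinite_set B ->
  (forall a b, B a -> B b -> a != b -> coprime a b) -> rich B.
Proof.
move=> Binf cop m m0; apply: contrapT => nrich.
have shared b : B b -> (2 <= gcdn b m)%N.
  move=> Bb; have : (0 < gcdn b m)%N by rewrite gcdn_gt0 m0 orbT.
  move=> g0; rewrite ltn_neqAle g0 andbT; apply/eqP => bm; apply: nrich.
  by exists b => //; rewrite /coprime -bm.
have [X XB mX] := infinite_set_fset m Binf.
have XB' : {in finmap.enum_fset X, forall b, B b} by move=> b bX; apply: XB.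
move: (finmap.fset_uniq X) mX XB'; move: (finmap.enum_fset X : seq nat) => s us ms sB.
have prod_dvd (s' : seq nat) : uniq s' -> {in s', forall b, B b} ->
    (\prod_(b <- s') gcdn b m %| m)%N /\ (2 ^ size s' <= \prod_(b <- s') gcdn b m)%N.
  elim: s' => [_ _|b s' IH /= /andP[bs us'] sB']; first by rewrite big_nil dvd1n.
  have [|d1 d2] := IH us' _; first by move=> c cs; apply: sB'; rewrite in_cons cs orbT.
  rewrite big_cons; split; last first.
    by rewrite expnS leq_mul//; apply/shared/sB'/mem_head.
  rewrite Gauss_dvd ?dvdn_gcdr ?d1//.
  apply: coprime_prodr => c cs; apply: coprime_dvdl (dvdn_gcdl _ _) _.
  apply: coprime_dvdr (dvdn_gcdl _ _) _; apply: cop.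
  - exact/sB'/mem_head.
  - by apply: sB'; rewrite in_cons cs orbT.
  - by apply: contraNneq bs => ->.
have [d1 d2] := prod_dvd s us sB.
have := leq_trans d2 (dvdn_leq m0 d1); rewrite leqNgt => /negP; apply.
by apply: (leq_trans (ltn_expl m (ltnSn 1))); rewrite leq_exp2l.
Qed.

End ErdosSums.

(** * The B-free subshift *)

Lemma nat_residue (z : int) b : (0 < b)%N -> exists (r : nat) (k : int), r%:Z = z + k * b%:Z.
Proof.
move=> b0; exists (absz (z %% b%:Z)%Z), (- (z %/ b%:Z)%Z).
rewrite gez0_abs ?modz_ge0 ?eqz_nat -?lt0n//.
by rewrite {2}(divz_eq z b%:Z) mulNr addrAC subrr add0r.
Qed.

Section Cylinders.
Variable R : realType.
Implicit Types (x y : config) (w : nat).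

Definition cylinder w x : set config := [set y | forall i : int, (`|i| <= w)%N -> y i = x i].

Lemma iter_left_shift n x : iter n left_shift x = shiftz n%:Z x.
Proof.
elim: n => [|n IH]; apply/funext => i; first by rewrite /shiftz addr0.
by rewrite iterS IH /left_shift /shiftz -addrA -PoszD add1n.
Qed.

Lemma cdist_le w x y : (forall i : int, (`|i| <= w)%N -> x i = y i) ->
  cdist R x y <= 2^-1 ^+ w.
Proof.
move=> xy; have [->|xNy] := eqVneq x y; first by rewrite cdistxx exprn_ge0// invr_ge0.
apply: ge_sup.
  apply: contrapT => /nonemptyPn e0; move: (cdist_gt0 R xNy).
  by rewrite /cdist e0 sup0 ltxx.
move=> _ [i /= xyi <-]; rewrite ler_iXn2l ?invr_gt0 ?invf_lt1 ?ltr1n//.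
rewrite leqNgt; apply/negP => /ltnW /xy xyi'; by rewrite xyi' eqxx in xyi.
Qed.

Lemma eq_of_cdist_lt w x y : cdist R x y < 2^-1 ^+ w ->
  forall i : int, (`|i| <= w)%N -> x i = y i.
Proof.
move=> xy i iw; apply/eqP; apply: contraTT xy => xyi.
rewrite -leNgt; apply: le_trans (cdist_lb R xyi).
by rewrite ler_wiXn2l ?invr_ge0// invf_le1 ?ler1n.
Qed.

Lemma exp2V_small (e : R) : 0 < e -> exists k, 2^-1 ^+ k < e.
Proof.
move=> e0; have /cvgrPdist_lt/(_ _ e0)[k _ /(_ k)] :
    (fun n : nat => 2^-1 ^+ n : R) @ \oo --> (0 : R).
  by apply: cvg_expr; rewrite ger0_norm ?invr_ge0// invf_lt1 ?ltr1n.
rewrite /= leqnn sub0r normrN ger0_norm ?exprn_ge0 ?invr_ge0// => /(_ isT) h.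
by exists k.
Qed.

End Cylinders.

(* R does not occur in the conclusion: it only feeds the metric [cdist]. *)
Lemma nbhs_cylinder (R : realType) (x : config) (A : set config) :
  nbhs x A <-> exists w, cylinder w x `<=` A.
Proof.
split=> [/(nbhs_cdist R)[e e0 eA]|[w wA]].
  have [k ke] := exp2V_small e0; exists k => y xy; apply: eA => /=.
  by apply: le_lt_trans ke; apply: cdist_le => i /xy.
apply/(nbhs_cdist R); exists (2^-1 ^+ w); first by rewrite exprn_gt0 ?invr_gt0.
by move=> y /= xy; apply: wA => i iw; rewrite (eq_of_cdist_lt xy).
Qed.

Section OrbitClosure.
Variable R : realType.

Lemma orbit_closureP (x y : config) : orbit_closure x y <->
  forall w, exists j : int, forall i : int, (`|i| <= w)%N -> y i = x (i + j).
Proof.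
split=> [h w|h A /(nbhs_cylinder R)[w wA]].
  have [_ [[j _ <-] xy]] := h _ ((nbhs_cylinder R y (cylinder w y)).2
    (ex_intro _ w (@subset_refl _ _))).
  by exists j => i /xy.
have [j hj] := h w; exists (shiftz j x); split; first by exists j.
by apply: wA => i /hj ->.
Qed.

Lemma orbit_closure_shift (x y : config) j :
  orbit_closure x y -> orbit_closure x (shiftz j y).
Proof.
move=> /orbit_closureP h; apply/orbit_closureP => w.
have [k hk] := h (w + `|j|)%N; exists (j + k) => i iw.
by rewrite /shiftz hk ?addrA//; lia.
Qed.

Lemma orbit_closure_refl (x : config) : orbit_closure x x.
Proof. by apply/orbit_closureP => w; exists 0 => i _; rewrite addr0. Qed.

End OrbitClosure.

Section BFreeShift.
Variables (R : realType) (B : set nat).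
Hypothesis B_gt1 : forall b, B b -> (1 < b)%N.

Lemma etaP (n : int) : reflect (forall b, B b -> ~~ (b%:Z %| n)%Z) (eta B n).
Proof.
apply: (iffP (asboolP _)) => [[_ h] b Bb|h].
  by apply/negP => bn; apply: h; exists b.
by split => // -[b Bb /=]; apply/negP; exact: h.
Qed.

Lemma eta_nat n : eta B n%:Z = freeB B n.
Proof. exact: bfree_nat. Qed.

(** If x met every class modulo b, a window holding one representative [f r] of each would be copied
    from eta, with one of them landing on a multiple of b. *)
Lemma X_eta_adm : X_eta B `<=` X_adm B.
Proof.
move=> x /(orbit_closureP R) xP b Bb; have b0 := ltnW (B_gt1 Bb).
apply: contrapT => /forallNP h.
have /choice[f fP] : forall r : int, exists n : int, x n /\ (n = r %[mod b%:Z])%Z.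
  move=> r; have /existsNP[n /not_implyP[xn /negP]] := h r.
  by rewrite negbK => /eqP nr; exists n.
have [j hj] := xP (\sum_(i < b) `|f i%:Z|)%N.
have [r0 [k0 rE0]] := nat_residue (- j) b0.
pose r := (r0 %% b)%N; have rb : (r < b)%N by rewrite ltn_pmod.
have [xr fr] := fP r%:Z.
have : (`|f r| <= \sum_(i < b) `|f i%:Z|)%N.
  by rewrite (bigD1 (Ordinal rb))//= leq_addr.
move=> /hj; rewrite xr => /esym/etaP/(_ b Bb)/negP; apply.
apply/dvdz_mod0P; rewrite -modzDml fr -modz_nat modz_mod modzDml rE0.
by rewrite addrAC addNr add0r modzMl.
Qed.

Lemma X_adm_pattern (x : config) w b : X_adm B x -> B b ->
  exists r, forall i, x (i%:Z - w%:Z) -> ~~ (b %| r + i)%N.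
Proof.
move=> xadm Bb; have b0 := ltnW (B_gt1 Bb); have [r rP] := xadm b Bb.
have [r' [k rE]] := nat_residue (- (r + w%:Z)) b0.
exists r' => i /rP; apply: contra => bri.
have {}bri : (b%:Z %| r'%:Z + i%:Z)%Z by rewrite -PoszD dvdzE.
rewrite eqz_mod_dvd; move: bri; rewrite rE => bri.
rewrite (_ : _ - _ = (- (r + w%:Z) + k * b%:Z + i%:Z) - k * b%:Z); last by ring.
by apply: rpredB => //; exact: dvdz_mull.
Qed.

Lemma X_adm_sub_X_eta :
  (forall W (z : pred nat),
    (forall b, B b -> exists r, forall i, (i < W)%N -> z i -> ~~ (b %| r + i)%N) ->
    exists j, forall i, (i < W)%N -> freeB B (j + i)%N = z i) ->
  X_adm B `<=` X_eta B.
Proof.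
move=> pat x xadm; apply/(orbit_closureP R) => w.
have [|j jP] := pat (w + w).+1 (fun i : nat => x (i%:Z - w%:Z)).
  by move=> b Bb; have [r rP] := X_adm_pattern w xadm Bb; exists r => i _; exact: rP.
exists (j + w)%:Z => i iw.
have iE : i = (absz (i + w%:Z))%:Z - w%:Z by lia.
rewrite {1}iE -jP; last by lia.
by rewrite -eta_nat; congr eta; lia.
Qed.

End BFreeShift.

Section AdmissibleShift.
Variables (R : realType) (B : set nat).
Hypothesis B_gt1 : forall b, B b -> (1 < b)%N.
Hypothesis adm_eta : X_adm B `<=` X_eta B.

(** The indicator of A is admissible, hence copied from eta at some integer j; reducing j modulo N!
    to a natural number preserves freeness up to N. *)
Lemma admissible_seq_occurs (A : seq nat) N :
  (forall c, B c -> exists r, forall n, n \in A -> (n != r %[mod c])%N) ->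
  exists j, forall n, n \in A -> freeK B N (n + j)%N.
Proof.
move=> adm; pose x : config := fun n => (0 <= n) && (absz n \in A).
have xA n : n \in A -> x n%:Z by move=> nA; rewrite /x.
have : X_adm B x.
  move=> b /adm[r rP]; exists r%:Z => n /andP[n0 /rP].
  by rewrite -{2}(gez0_abs n0) !modz_nat.
move=> /adm_eta/(orbit_closureP R) h; have [j hj] := h (\sum_(n <- A) n)%N.
have [j' [k jE]] := nat_residue j (fact_gt0 N).
exists j' => n nA; apply/free_ofP => b bN; apply/negP => bnj.
have Bb := Bseq_B B_gt1 bN.
have : eta B (n%:Z + j).
  rewrite -hj ?xA//=; rewrite (perm_big _ (perm_to_rem nA)) big_cons.
  exact: leq_addr.
move=> /etaP/(_ b Bb)/negP; apply.
have -> : n%:Z + j = (n + j')%N%:Z - k * N`!%:Z by rewrite PoszD jE; ring.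
apply: rpredB; first by rewrite dvdzE.
by apply: dvdz_mull; rewrite dvdzE/= (Bseq_dvd_fact B_gt1 bN).
Qed.

(** The zero configuration is admissible, but for finite B bounded by K, eta is 1 on the class of 1
    modulo K!, so its runs of zeros are bounded. *)
Lemma infinite_of_admissible : infinite_set B.
Proof.
move=> Bfin; have [K BK] : exists K, forall b, B b -> (b <= K)%N.
  have /finite_seqP[s sB] := Bfin; exists (\sum_(b <- s) b)%N => b.
  rewrite sB /= => bs; rewrite (perm_big _ (perm_to_rem bs)) big_cons.
  exact: leq_addr.
have : X_adm B (fun=> false) by move=> b _; exists 0.
move=> /adm_eta/(orbit_closureP R)/(_ K`!)[j hj].
have [i [k iE]] := nat_residue (1 - j) (fact_gt0 K).
pose i' := (i %% K`!)%N.
have : (`|i'%:Z| <= K`!)%N by rewrite /i' ltnW// ltn_pmod// fact_gt0.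
move=> /hj /esym/negP; apply; apply/etaP => b Bb; apply/negP => bij.
have bK : (b%:Z %| K`!%:Z)%Z.
  by rewrite dvdzE/= dvdn_fact// (BK _ Bb) andbT ltnW// B_gt1.
have iE' : i%:Z = (i %/ K`!)%:Z * K`!%:Z + i'%:Z by rewrite {1}(divn_eq i K`!) PoszD PoszM.
have : (b%:Z %| (i'%:Z + j) + ((i %/ K`!)%:Z * K`!%:Z - k * K`!%:Z))%Z.
  by apply: rpredD => //; apply: rpredB; exact: dvdz_mull.
have -> : i'%:Z + j + ((i %/ K`!)%:Z * K`!%:Z - k * K`!%:Z) = 1.
  move: iE'; rewrite iE => e; have -> : i'%:Z = 1 - j + k * K`!%:Z - (i %/ K`!)%:Z * K`!%:Z.
    by rewrite e; ring.
  by ring.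
by rewrite dvdz1/= => /eqP b1; have := B_gt1 Bb; rewrite b1.
Qed.

End AdmissibleShift.

(** * Proximality and elements coprime to a given integer *)

Section Proximality.
Variables (R : realType) (B : set nat).
Hypothesis B_gt1 : forall b, B b -> (1 < b)%N.

(** Each of the 2 K + 1 positions gets two moduli of its own, one for x and one for y; Chinese
    remainders move it into the class missed by x modulo the first and by y modulo the second. *)
Lemma common_zeros (x y : config) K : rich B -> X_adm B x -> X_adm B y ->
  exists q : nat, forall i : int, (`|i| <= K)%N ->
    x (i + q%:Z) = false /\ y (i + q%:Z) = false.
Proof.
move=> rB xadm yadm; pose W := (K + K).+1.
have [f [fB _ fc]] := rich_family (W + W) B_gt1 rB (ltn0Sn 0).
have f0 i : (i < W + W)%N -> (0 < f i)%N by move/fB/B_gt1/ltnW.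
have key (u : config) i n : X_adm B u -> (i < W + W)%N -> exists r : nat, forall q : nat,
    (f i %| q + r)%N -> u ((n%:Z - K%:Z) + q%:Z) = false.
  move=> uadm iW; have [rho rhoP] := uadm _ (fB _ iW).
  have [r [k rE]] := nat_residue (- (rho - (n%:Z - K%:Z))) (f0 _ iW).
  exists r => q fqr; apply/negP => /rhoP/negP; apply.
  rewrite eqz_mod_dvd.
  have -> : n%:Z - K%:Z + q%:Z - rho = (q + r)%N%:Z - k * (f i)%:Z.
    by rewrite PoszD rE; ring.
  by rewrite rpredB ?dvdz_mull// dvdzE.
have /choice[r rP] : forall i : nat, exists r : nat, (i < W + W)%N -> forall q : nat,
    (f i %| q + r)%N ->
    (if (i < W)%N then x else y) (((if i < W then i else i - W)%N%:Z - K%:Z) + q%:Z) = false.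
  move=> i; have [iW|_] := ltnP i (W + W); last by exists 0%N.
  have [r rP] := key (if (i < W)%N then x else y) i (if i < W then i else i - W)%N
    ltac:(by case: ifP) iW.
  by exists r => _.
have [i|i j|q qP] := @chinese_seq _ (iota 0 (W + W)) f r (iota_uniq _ _).
- by rewrite mem_iota => /andP[_ /f0].
- by rewrite !mem_iota => /andP[_ iW] /andP[_ jW]; exact: fc.
exists q => i iK; pose n := absz (i + K%:Z).
have nW : (n < W)%N by rewrite /n /W; lia.
have iE : i = n%:Z - K%:Z by rewrite /n; lia.
have nWW : (n < W + W)%N by rewrite ltn_addr.
have nWW' : (n + W < W + W)%N by rewrite ltn_add2r.
split.
  have := rP _ nWW q; rewrite nW -iE; apply; apply: qP.
  by rewrite mem_iota.
have := rP _ nWW' q; rewrite ltnNge leq_addl/= addnK -iE; apply; apply: qP.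
by rewrite mem_iota.
Qed.

Lemma proximal_of_rich : rich B -> proximal (cdist R) left_shift (X_eta B).
Proof.
move=> rB x y /(X_eta_adm R B_gt1) xadm /(X_eta_adm R B_gt1) yadm.
have /choice[q qP] := fun K => common_zeros K rB xadm yadm.
exists q; apply: (@squeeze_cvgr _ _ _ _ (cst 0) (fun n : nat => 2^-1 ^+ n)).
- apply: nearW => n; rewrite cdist_ge0/=; apply: cdist_le => i iK.
  by rewrite !iter_left_shift /shiftz; have [-> ->] := qP n i iK.
- exact: cvg_cst.
- by apply: cvg_expr; rewrite ger0_norm ?invr_ge0// invf_lt1 ?ltr1n.
Qed.

(** The test pair is eta and its shift by -1. If every b shares a factor with m, eta is 1 on the
    class of 1 modulo m and 0 on multiples of b0, so the pair disagrees somewhere in any window of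
    length m b0. *)
Lemma rich_of_proximal : B !=set0 -> proximal (cdist R) left_shift (X_eta B) -> rich B.
Proof.
move=> [b0 Bb0] prox m m0; apply: contrapT => h.
have b0_gt0 : (0 < b0)%N by apply/ltnW/B_gt1.
pose M := (m * b0)%N; have M0 : (0 < M)%N by rewrite muln_gt0 m0.
have etax : X_eta B (eta B) by exact: (orbit_closure_refl R).
have etay : X_eta B (shiftz (-1) (eta B)) by exact: (orbit_closure_shift R).
have [q /cvgrPdist_lt/(_ (2^-1 ^+ M))] := prox _ _ etax etay.
rewrite exprn_gt0 ?invr_gt0// => /(_ isT)[N _ /(_ N (leqnn N))] /=.
rewrite sub0r normrN ger0_norm ?cdist_ge0// !iter_left_shift => close.
have [i iM iq] := exists_neg_residue (q N + M.-1) M0.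
have := eq_of_cdist_lt close (i := i%:Z) (ltnW iM); rewrite /shiftz => e.
have {}iq : (M%:Z %| i%:Z + (q N)%:Z - 1)%Z.
  have -> : i%:Z + (q N)%:Z - 1 = (i + (q N + M.-1))%N%:Z - M%:Z by lia.
  by rewrite rpredB// dvdzE.
have : eta B (i%:Z + (q N)%:Z).
  rewrite -PoszD eta_nat; apply/freeBP => b Bb; apply/negP => biq.
  apply: h; exists b => //; apply: coprime_dvdl biq _.
  rewrite -coprime_modl.
  have -> : (i + q N = 1 %[mod m])%N.
    have mM : (m%:Z %| M%:Z)%Z by rewrite dvdzE/= dvdn_mulr.
    have /dvdzP[k kE] := dvdz_trans mM iq.
    apply/eqP; rewrite -eqz_nat -!modz_nat eqz_mod_dvd.
    by rewrite PoszD kE dvdz_mull.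
  by rewrite coprime_modl coprime1n.
rewrite e => /etaP/(_ b0 Bb0)/negP; apply.
by apply: dvdz_trans iq; rewrite dvdzE/= dvdn_mull.
Qed.

End Proximality.

(** * Entropy *)

Section CoverNumbers.
Variable R : realType.

Lemma finite_subcover_seq (E : topologicalType) (X : set E) (J : set (set E))
    (I : eqType) (s : seq I) (V : I -> set E) :
  (forall i, i \in s -> J (V i)) -> (forall x, X x -> exists2 i, i \in s & V i x) ->
  X !=set0 -> exists2 k, (k <= size s)%N &
    exists A : set (set E), [/\ A `<=` J, (A #= `I_k)%card & X `<=` \bigcup_(W in A) W].
Proof.
move=> VJ VX [x0 /VX[i0 i0s _]].
pose A := (fun n => V (nth i0 s n)) @` `I_(size s).
have Afin : finite_set A by apply: finite_image; exact: finite_II.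
have [k Ak] := (finite_setP A).1 Afin.
exists k.
  rewrite -card_le_II; apply: card_le_trans (card_image_le (fun n => V (nth i0 s n)) _).
  by move: Ak; rewrite card_eq_le => /andP[].
exists A; split => //.
  by move=> _ [n /= ns <-]; apply: VJ; exact: mem_nth.
move=> x /VX[i is_ Vx]; exists (V i) => //; exists (index i s) => /=.
  by rewrite index_mem.
by rewrite nth_index.
Qed.

Lemma cover_number_le (E : topologicalType) (X : set E) (J : set (set E)) k N :
  (k <= N)%N -> (exists A : set (set E),
    [/\ A `<=` J, (A #= `I_k)%card & X `<=` \bigcup_(W in A) W]) ->
  cover_number R X J <= N%:R.
Proof.
move=> kN kA; apply: (@le_trans _ _ k%:R); last by rewrite ler_nat.
apply: ge_inf; first by exists 0 => _ [n _ <-].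
by exists k.
Qed.

(** The finite subcover in the first premise matters because [inf] of the empty set is 0. The m
    points lie in distinct members of any subcover. *)
Lemma cover_number_ge (E : topologicalType) (X : set E) (J : set (set E)) (m : nat) :
  (exists k, exists A : set (set E),
    [/\ A `<=` J, (A #= `I_k)%card & X `<=` \bigcup_(W in A) W]) ->
  (exists2 f : nat -> E, (forall i, (i < m)%N -> X (f i)) &
    forall W i j, J W -> (i < m)%N -> (j < m)%N -> W (f i) -> W (f j) -> i = j) ->
  m%:R <= cover_number R X J.
Proof.
move=> [k0 kA] [f fX fJ]; apply: lb_le_inf; first by exists k0%:R; exists k0.
move=> _ [k [A [AJ Ak XA]] <-]; rewrite ler_nat -card_le_II.
have /choice[g gP] : forall i, exists W, (i < m)%N -> A W /\ W (f i).
  move=> i; have [im|//] := pselect (i < m)%N; last by exists set0.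
  by have [W AW Wf] := XA _ (fX _ im); exists W.
apply: (@card_le_trans _ _ _ A); last by move: Ak; rewrite card_eq_le => /andP[].
have ginj : {in `I_m &, injective g}.
  move=> i j; rewrite !inE /= => im jm gij; have [Ai gi] := gP i im.
  have [_ gj] := gP j jm; apply: (fJ (g i)) => //; first exact: AJ.
  by rewrite gij.
have := inj_card_eq ginj; rewrite card_eq_sym card_eq_le => /andP[h _].
apply: card_le_trans h _; apply: subset_card_le => _ [i /= im <-].
by have [] := gP i im.
Qed.

Lemma ln_cover_number_ge0 (E : topologicalType) (X : set E) (J : set (set E)) :
  X !=set0 -> 0 <= ln (cover_number R X J).
Proof.
move=> [x Xx]; rewrite /cover_number; set S := [set _ | _ in _].
(* Without a finite subcover the infimum defaults to 0, and [ln 0] is 0. *)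
have [->|/set0P S0] := eqVneq S set0; first by rewrite inf0 ln0.
apply: ln_ge0; apply: lb_le_inf => // _ [[|k] [A [_ Ak XA]] <-]; last by rewrite ler1n.
have A0 : A = set0 by apply/eqP; rewrite -(@card_eq0 _ nat) -II0.
by have [V] := XA _ Xx; rewrite A0.
Qed.

Lemma ln_le_nat (x : R) N : (0 < N)%N -> x <= N%:R -> ln x <= ln N%:R.
Proof.
move=> N0 xN; have [x0|x0] := ltP 0 x.
  by rewrite ler_ln ?posrE ?ltr0n.
by rewrite (ln0 x0) ln_ge0// ler1n.
Qed.

Lemma limn_esup_le (u : nat -> R) (c : R) N0 : (forall n, (N0 <= n)%N -> u n <= c) ->
  (limn_esup (fun n => (u n)%:E) <= c%:E)%E.
Proof.
move=> uc; apply: ge_ereal_inf.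
exists (ereal_sup [set (u n)%:E | n in [set n | (N0 <= n)%N]]).
  by exists [set n | (N0 <= n)%N] => //; exists N0.
by apply: ge_ereal_sup => _ [n /= nN <-]; rewrite lee_fin uc.
Qed.

Lemma limn_esup_ge (u : nat -> R) (c : R) : (forall n, (0 < n)%N -> c <= u n) ->
  (c%:E <= limn_esup (fun n => (u n)%:E))%E.
Proof.
move=> uc; apply: le_ereal_inf_tmp => _ [A [N0 _ NA] <-].
apply: (@le_trans _ _ (u N0.+1)%:E); first by rewrite lee_fin uc.
by apply: ereal_sup_ubound; exists N0.+1 => //; apply: NA => /=.
Qed.

Lemma entropy_ge0 (E : topologicalType) (T : E -> E) (X : set E) :
  X !=set0 -> (0 <= entropy R T X)%E.
Proof.
move=> X0; apply: (@le_trans _ _ (cover_entropy R T X [set setT])).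
  by apply: limn_esup_ge => n _; rewrite divr_ge0// ln_cover_number_ge0.
apply: ereal_sup_ubound; exists [set setT] => //; split.
  by move=> _ ->; exact: openT.
by move=> x _; exists setT.
Qed.

End CoverNumbers.

(** * Covers of subshifts by cylinders *)

Section ShiftCovers.
Variable R : realType.

Lemma compact_config : compact [set: config].
Proof.
have := @tychonoff int (fun _ => bool) (fun _ => setT) (fun _ => bool_compact).
by congr compact; apply/seteqP; split.
Qed.

Lemma open_cylinder0 (e : bool) : open [set x : config | x 0 = e].
Proof.
rewrite openE => x /= xe; apply/(nbhs_cylinder R); exists 0%N => y h /=.
by rewrite h.
Qed.

(** The Lebesgue number lemma: bad points [u w] would cluster at some x, and a cylinder around x
    inside a member of U gives the contradiction. *)
Lemma lebesgue_cylinder (X : set config) U : compact X -> open_cover X U ->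
  exists w, forall x, X x -> exists2 V, U V & cylinder w x `<=` V.
Proof.
move=> Xc [Uo XU]; apply: contrapT => /forallNP h.
have /choice[u uP] : forall w, exists x, X x /\ forall V, U V -> ~ cylinder w x `<=` V.
  move=> w; have /existsNP[x /not_implyP[Xx nV]] := h w.
  by exists x; split => // V UV xV; apply: nV; exists V.
have [|x [Xx clx]] := Xc (u @ \oo) _.
  by exists 0%N => // n _; exact: (uP n).1.
have [V UV Vx] := XU x Xx.
have [w wV] := (nbhs_cylinder R x V).1 (open_nbhs_nbhs (conj (Uo _ UV) Vx)).
have nx : nbhs x (cylinder w x) by apply/(nbhs_cylinder R); exists w.
have [|_ [[n wn <-] xn]] := clx [set u n | n in [set n | (w <= n)%N]] _ _ nx.
  by exists w => // n wn; exists n.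
apply: ((uP n).2 _ UV) => y yn; apply: wV => i iw.
by rewrite yn ?xn//; exact: leq_trans wn.
Qed.

(** The word of length N starting at position -c, as the set of its ones, so that words are counted
    by powersets. *)
Definition word N c (x : config) : {set 'I_N} := finset (fun i : 'I_N => x (i%:Z - c%:Z)).

Lemma word_cylinder w (x y : config) :
  word (w + w).+1 w x = word (w + w).+1 w y -> cylinder w x y.
Proof.
move=> /setP e i iw; have iN : (absz (i + w%:Z)%R < (w + w).+1)%N by lia.
have := e (Ordinal iN); rewrite !inE /=.
have -> : (absz (i + w%:Z)%R)%:Z - w%:Z = i by lia.
by [].
Qed.

(** Radius w + n around x determines the first n shifts of x up to radius w. *)
Lemma join_cylinder (X : set config) U w : (forall x n, X x -> X (shiftz n%:Z x)) ->
  (forall x, X x -> exists2 V, U V & cylinder w x `<=` V) ->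
  forall n x, X x -> exists2 V, cover_join left_shift U n V & cylinder (w + n) x `<=` V.
Proof.
move=> Xs leb n x Xx.
have /choice[F FP] : forall i : nat, exists V, U V /\ cylinder w (shiftz i%:Z x) `<=` V.
  by move=> i; have [V UV h] := leb _ (Xs _ i Xx); exists V.
exists (\bigcap_(i < n) (iter i left_shift @^-1` F i)).
  by exists F => // i _; exact: (FP i).1.
move=> y xy i /= i_n; rewrite iter_left_shift; apply: (FP i).2 => k kw.
by rewrite /shiftz xy//; lia.
Qed.

(* A cylinder lying in a member of the joined cover is determined by its word. *)
Lemma join_cover_words (X : set config) U : compact X -> X !=set0 ->
  (forall x n, X x -> X (shiftz n%:Z x)) -> open_cover X U ->
  exists w, forall n, exists2 k,
    (k <= #|finset (fun v => `[< exists2 x, X x &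
               word ((w + n) + (w + n)).+1 (w + n) x = v >])|)%N &
    exists A : set (set config), [/\ A `<=` cover_join left_shift U n, (A #= `I_k)%card &
      X `<=` \bigcup_(W in A) W].
Proof.
move=> Xc X0 Xs UX; have [w leb] := lebesgue_cylinder Xc UX.
exists w => n; set N := _.+1; set c := (w + n)%N.
set D := finset _.
have /choice[V VP] : forall v : {set 'I_N}, exists V, v \in D ->
    cover_join left_shift U n V /\ forall x, word N c x = v -> V x.
  move=> v; have [|_] := boolP (v \in D); last by exists set0.
  rewrite inE => /asboolP[x Xx xv]; have [V JV xV] := join_cylinder Xs leb n Xx.
  exists V => _; split => // y yv; apply: xV; apply: word_cylinder.
  by rewrite xv yv.
have := @finite_subcover_seq _ X (cover_join left_shift U n) _ (enum D) V.
rewrite -cardE; apply => //.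
  by move=> v; rewrite mem_enum => /VP[].
move=> x Xx; have xD : word N c x \in D by rewrite inE; apply/asboolP; exists x.
by exists (word N c x); rewrite ?mem_enum//; have [_] := VP _ xD; apply.
Qed.

End ShiftCovers.

Section BFreeEntropy.
Variables (R : realType) (B : set nat).
Hypothesis B_gt1 : forall b, B b -> (1 < b)%N.

Lemma X_eta_compact : compact (X_eta B).
Proof.
apply: (@subclosed_compact _ _ setT) => //; first exact: closed_closure.
exact: compact_config.
Qed.

Lemma X_eta_nonempty : X_eta B !=set0.
Proof. by exists (eta B); exact: (orbit_closure_refl R). Qed.

Lemma X_eta_shift x n : X_eta B x -> X_eta B (shiftz n%:Z x).
Proof. exact: (orbit_closure_shift R). Qed.

(** Up to the residue r of its place in eta modulo K!, the ones of a word lie in the set [F r] of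
    positions free up to K. *)
Lemma card_words N c K :
  (#|finset (fun v => `[< exists2 x, X_eta B x & word N c x = v >])| <=
   K`! * 2 ^ ((N %/ K`!).+1 * cnt (freeK B K) K`!))%N.
Proof.
pose F (r : 'I_K`!) : {set 'I_N} := finset (fun i : 'I_N => freeK B K (r + i)%N).
set D := finset _.
have DF : D \subset (\bigcup_(r < K`!) powerset (F r))%SET.
  apply/fintype.subsetP => v; rewrite inE => /asboolP[x /(orbit_closureP R) xP <-].
  have [j hj] := xP (N + c)%N.
  have [r [k rE]] := nat_residue (j - c%:Z) (fact_gt0 K).
  apply/bigcupP; exists (Ordinal (ltn_pmod r (fact_gt0 K))) => //.
  rewrite powersetE; apply/fintype.subsetP => i; rewrite !inE => xi.
  have -> : freeK B K (r %% K`! + i)%N = freeK B K (r + i)%N.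
    rewrite -(periodic_mod _ (@freeK_periodic B B_gt1 K)) modnDml.
    by rewrite (periodic_mod _ (@freeK_periodic B B_gt1 K)).
  apply/free_ofP => b bK; apply/negP => bri.
  have : eta B (i%:Z - c%:Z + j) by rewrite -hj ?xi//; have := ltn_ord i; lia.
  move=> /etaP/(_ b (Bseq_B B_gt1 bK))/negP; apply.
  have -> : i%:Z - c%:Z + j = (r + i)%N%:Z - k * K`!%:Z by rewrite PoszD rE; ring.
  apply: rpredB; first by rewrite dvdzE.
  by apply: dvdz_mull; rewrite dvdzE/= (Bseq_dvd_fact B_gt1 bK).
apply: leq_trans (subset_leq_card DF) _.
apply: (@leq_trans (\sum_(r < K`!) 2 ^ #|F r|)%N).
  elim/big_ind2 : _ => [|A m A' m' Am Am'|r _]; first by rewrite cards0.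
    by apply: leq_trans (leq_card_setU _ _) _; exact: leq_add.
  by rewrite card_powerset.
rewrite -[X in (_ <= X * _)%N](card_ord K`!) -sum_nat_const; apply: leq_sum => r _.
rewrite leq_exp2l//; apply: leq_trans (cnt_le_window r N (fact_gt0 K) (@freeK_periodic B B_gt1 K)).
rewrite big_mkord -sum1_card big_mkcond/=; apply: leq_sum => i _.
by rewrite inE; case: (freeK _ _ _).
Qed.

Lemma entropy_eq0 : (forall e : R, 0 < e -> exists K, dK R B K < e) ->
  entropy R left_shift (X_eta B) = 0%E.
Proof.
move=> small; apply/eqP; rewrite eq_le entropy_ge0 ?andbT; last exact: X_eta_nonempty.
apply/lee_addgt0Pr => e e0; rewrite add0e; apply: ge_ereal_sup => _ [U UX <-].
have [w wP] := join_cover_words R X_eta_compact X_eta_nonempty X_eta_shift UX.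
(* Words have length about 2 n, so they cost about n e / 2; the other half of n e absorbs the
   constant C once n > 2 C / e. *)
have [|K hK] := small (e / 4); first by rewrite divr_gt0.
have K0 : 0 < K`!%:R :> R by rewrite ltr0n fact_gt0.
have lnK0 : 0 <= ln (K`!%:R : R) by rewrite ln_ge0// ler1n fact_gt0.
pose C : R := ln K`!%:R + (w + w + 1 + K`!)%N%:R * (e / 4).
have C0 : 0 <= C by rewrite addr_ge0// mulr_ge0// divr_ge0// ltW.
apply: (@limn_esup_le _ _ _ (Num.bound (2 * C / e)).+1) => n nN.
have n0 : 0 < n%:R :> R by rewrite ltr0n (leq_trans _ nN).
have Cn : 2 * C / e < n%:R.
  apply: (@lt_le_trans _ _ (Num.bound (2 * C / e))%:R); last by rewrite ler_nat ltnW.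
  by apply: archi_boundP; rewrite divr_ge0// ?mulr_ge0// ltW.
rewrite ler_pdivrMr//; have [k kD kA] := wP n.
set N := (w + n + (w + n)).+1 in kD.
have kN := leq_trans kD (card_words N (w + n) K).
have pos : (0 < K`! * 2 ^ ((N %/ K`!).+1 * cnt (freeK B K) K`!))%N.
  by rewrite muln_gt0 fact_gt0 expn_gt0.
apply: le_trans (ln_le_nat pos (cover_number_le R kN kA)) _.
rewrite natrM lnM ?posrE ?ltr0n ?fact_gt0 ?expn_gt0// natrX lnXn// -[ln 2 *+ _]mulr_natl.
have ln2 : ln (2 : R) <= 1.
  by have := @le_ln1Dx R 1; apply; lra.
have ln20 : 0 <= ln (2 : R) by rewrite ln_ge0// ler1n.
have bnd : ((N %/ K`!).+1 * cnt (freeK B K) K`!)%N%:R <= (N + K`!)%N%:R * (e / 4) :> R.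
  have -> : ((N %/ K`!).+1 * cnt (freeK B K) K`!)%N%:R =
      ((N %/ K`!).+1 * K`!)%N%:R * dK R B K :> R.
    by rewrite !natrM /dK /dens -mulrA; congr (_ * _); rewrite mulrC divfK ?gt_eqF.
  apply: ler_pM => //; [exact: dK_ge0| |exact: ltW].
  by rewrite ler_nat mulSn addnC leq_add2r leq_trunc_div.
have : ((N %/ K`!).+1 * cnt (freeK B K) K`!)%N%:R * ln 2 <= (N + K`!)%N%:R * (e / 4) :> R.
  by apply: le_trans bnd; rewrite ler_piMr.
have -> : (N + K`!)%N%:R = (w + w + 1 + K`!)%N%:R + 2 * n%:R :> R.
  by rewrite -natrM -natrD (_ : N + K`! = w + w + 1 + K`! + 2 * n)%N// /N; lia.
rewrite mulrDl; move: Cn; rewrite ltr_pdivrMr// /C; set x := _%:R * (e / 4).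
set y := _%:R * ln 2; lra.
Qed.

Hypothesis B_rich : rich B.
Hypothesis theta_gt0 : 0 < theta R B.

(** For the partition by coordinate 0, a member of the n-fold join fixes coordinates 0 to n - 1, so
    the 2^|I| patterns on independent positions lie in distinct members. *)
Lemma entropy_gt0 : (0 < entropy R left_shift (X_eta B))%E.
Proof.
pose U : set (set config) := [set [set x : config | x 0 = e] | e in [set: bool]].
have UX : open_cover (X_eta B) U.
  split; first by move=> _ [e _ <-]; exact: (open_cylinder0 R).
  by move=> x _; exists [set y : config | y 0 = x 0] => //; exists (x 0).
have ln2 : 0 < ln (2 : R) by rewrite ln_gt0// ltr1n.
apply: (@lt_le_trans _ _ (theta R B / 2 * ln 2)%:E).
  by rewrite lte_fin mulr_gt0// divr_gt0.
apply: (@le_trans _ _ (cover_entropy R left_shift (X_eta B) U)); last first.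
  by apply: ereal_sup_ubound; exists U.
apply: limn_esup_ge => n n0; rewrite ler_pdivlMr ?ltr0n//.
have [I [Isize Ipat]] := independent_positions B_gt1 B_rich theta_gt0 n0.
have [w wP] := join_cover_words R X_eta_compact X_eta_nonempty X_eta_shift UX.
have : (2 ^ #|I|)%N%:R <= cover_number R (X_eta B) (cover_join left_shift U n).
  apply: cover_number_ge; first by have [k _ kA] := wP n; exists k.
  have /choice[x xP] : forall v : {set 'I_n}, exists x, X_eta B x /\
      forall i : 'I_n, i \in I -> x i%:Z = (i \in v).
    move=> v; have [j jP] := Ipat (fun m => if insub m is Some i then (i : 'I_n) \in v else false).
    exists (shiftz j%:Z (eta B)); split.
      by apply: X_eta_shift; exact: (orbit_closure_refl R).
    move=> i iI; rewrite /shiftz -PoszD eta_nat addnC jP// valK//.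
  have s_size : size (enum (powerset I)) = (2 ^ #|I|)%N by rewrite -cardE card_powerset.
  exists (fun m => x (nth finset.set0 (enum (powerset I)) m)).
    by move=> m _; exact: (xP _).1.
  move=> W m1 m2 [F FU ->] h1 h2; rewrite -s_size in h1 h2.
  set v1 := nth _ _ m1; set v2 := nth _ _ m2 => W1 W2.
  have v1I : v1 \subset I by rewrite -powersetE -mem_enum mem_nth.
  have v2I : v2 \subset I by rewrite -powersetE -mem_enum mem_nth.
  suff v12 : v1 = v2.
    by apply/eqP; rewrite -(nth_uniq finset.set0 h1 h2 (enum_uniq _)); apply/eqP.
  apply/setP => i; have [iI|iI] := boolP (i \in I); last first.
    by rewrite (contraNF (fintype.subsetP v1I i) iI) (contraNF (fintype.subsetP v2I i) iI).
  rewrite -(xP v1).2// -(xP v2).2//.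
  have [e _ Fe] := FU i (ltn_ord i).
  have eval v : F i (iter i left_shift (x v)) -> x v i%:Z = e.
    by rewrite -Fe /= iter_left_shift /shiftz add0r.
  by rewrite (eval _ (W1 i (ltn_ord i))) (eval _ (W2 i (ltn_ord i))).
move=> cov; apply: (@le_trans _ _ (ln (2 ^ #|I|)%N%:R)); last first.
  rewrite ler_ln// posrE ?ltr0n ?expn_gt0//.
  by apply: lt_le_trans cov; rewrite ltr0n expn_gt0.
by rewrite natrX lnXn// -[ln 2 *+ _]mulr_natl mulrAC ler_wpM2r// ltW.
Qed.

End BFreeEntropy.

(** For empty B, eta is constantly 1 and X_eta is a point, proximal with zero entropy, although the
    density is 1; hence the nonemptiness in the second equivalence. *)
Theorem corollary1p1 (R : realType) (B : set nat)
    (B_gt1 : forall b, B b -> (1 < b)%N) (B_prim : primitive B) :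
  (erdos R B <->
     X_eta B = X_adm B /\ (0 < entropy R left_shift (X_eta B))%E) /\
  (B !=set0 ->
     (behrend R B <->
        proximal (cdist R) left_shift (X_eta B) /\
        entropy R left_shift (X_eta B) = 0%E)).
Proof.
have theta_of_entropy : (0 < entropy R left_shift (X_eta B))%E -> 0 < theta R B.
  by have [/(entropy_eq0 B_gt1) ->|//] := theta_gt0P R B_gt1; rewrite ltxx.
split; [split=> [[Binf Bcop Bsum]|[Xeq hgt0]] | move=> B0; split=> [beh|[prox h0]]].
- have Brich := rich_of_coprime Binf Bcop.
  have Btail := summable_tail_of_esum B_gt1 Bsum.
  split.
    apply/seteqP; split; first exact: (X_eta_adm R B_gt1).
    apply: (X_adm_sub_X_eta R) => // W z.
    exact: (admissible_pattern_occurs B_gt1 Bcop Brich Btail).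
  apply: entropy_gt0 => //; have [|M _] := Btail 2^-1 0%N; first by rewrite invr_gt0.
  exact: theta_gt0_summable.
- have adm_eta : X_adm B `<=` X_eta B by rewrite Xeq.
  have Bcop a b : B a -> B b -> a != b -> coprime a b.
    apply: coprime_of_admissible_patterns => // A N.
    exact: (admissible_seq_occurs R B_gt1 adm_eta).
  split=> //; first exact: (infinite_of_admissible R B_gt1 adm_eta).
  exact/esum_of_theta/theta_of_entropy.
- split; first exact/proximal_of_rich/(rich_of_behrend B_gt1 beh).
  apply: entropy_eq0 => //; have [//|t0] := theta_gt0P R B_gt1.
  by case: (theta_eq0_of_behrend B_gt1 beh t0).
(* With coprime elements at hand, positive theta would give positive entropy; so the densities [dK]
   become arbitrarily small. *)
- have Brich := rich_of_proximal B_gt1 B0 prox.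
  have [|t0] := theta_gt0P R B_gt1; first exact: behrend_of_dK.
  by have := entropy_gt0 B_gt1 Brich t0; rewrite h0 ltxx.
Qed.
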